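(* Let $p\in(1,2]$, $q=\frac{p}{p-1}$, and let $(\mathcal B,\|\cdot\|)$ be a real Banach space that is $q$-uniformly convex with $q$-convexity constant $K=K_q(\mathcal B)<\infty$. Let $F:\mathcal B\to\mathbb R$ be Fréchet differentiable and let $\Delta_1<\infty$, $L>0$, $\sigma>0$ be such that: (1) $F(x_1)-\inf_{x\in\mathcal B}F(x)\le\Delta_1$; (2) $\|\nabla F(x)-\nabla F(y)\|_*\le L\|x-y\|$ for all $x,y\in\mathcal B$; (3) the stochastic gradient oracle satisfies $\mathbb E[\nabla f(x,\xi)]=\nabla F(x)$ and $\mathbb E[\|\nabla f(x,\xi)-\nabla F(x)\|_*^p]\le\sigma^p$ for all $x\in\mathcal B$. Let $T\in\mathbb N_{\ge1}$. Then the iterates of NSSD-M with the constant parameters $$\eta_t\equiv\sqrt{\frac{\Delta_1(1-\beta)}{LT}},\qquad \beta_t\equiv\beta=1-\min\Big\{1,\max\Big\{T^{-\frac{p}{2p-1}},\Big(\frac{\Delta_1L}{\sigma^2K^2T}\Big)^{\frac{p}{3p-2}}\Big\}\Big\}$$ satisfy $$\frac1T\sum_{t=1}^T\mathbb E\big[\|\nabla F(x_t)\|_*\big]\le 9\sqrt{\frac{\Delta_1L}{T}}+14\Big(\frac{\Delta_1L}{T}(\sigma K)^{\frac{p}{p-1}}\Big)^{\frac{p-1}{3p-2}}+10\,\frac{\sigma K}{T^{\frac{p-1}{2p-1}}}.$$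
   Context: $(\mathcal B^*,\|\cdot\|_* )$ is the dual Banach space, $\langle x^*,x\rangle=x^*(x)$ the duality pairing, and $\nabla F(x)\in\mathcal B^*$ denotes the Fréchet derivative of $F$ at $x$. The stochastic gradient oracle is a map $(x,\xi)\mapsto\nabla f(x,\xi)\in\mathcal B^*$, where $\xi$ is a random variable. NSSD-M (normalised stochastic steepest descent with momentum): given an initial point $x_1\in\mathcal B$, stepsizes $\eta_t$, momentum parameters $\beta_t\in[0,1)$ and independent copies $\xi_1,\xi_2,\dots$ of $\xi$, set $m_0=\nabla f(x_1,\xi_1)$ and, for $t\ge1$, $$m_t=\beta_tm_{t-1}+(1-\beta_t)\nabla f(x_t,\xi_t),\qquad x_{t+1}=x_t+\eta_td_t,\quad d_t\in\arg\min_{\|d\|\le1}\langle m_t,d\rangle .$$ The $q$-convexity constant of a Banach space $X$ is $K_q(X)=\inf\{K\ge1:\ 2\|x\|^q+\frac{2}{K^q}\|y\|^q\le\|x+y\|^q+\|x-y\|^q\ \ \forall x,y\in X\}$; $X$ is called $q$-uniformly convex if $K_q(X)<\infty$. *)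

(* Defs.v *)
From HB Require Import structures.
From mathcomp Require Import all_boot all_order all_algebra finmap.
From mathcomp Require Import all_classical all_reals all_analysis.

Set Implicit Arguments.
Unset Strict Implicit.
Unset Printing Implicit Defensive.

Import Order.TTheory GRing.Theory Num.Theory.
Import numFieldNormedType.Exports.

Local Open Scope classical_set_scope.
Local Open Scope ring_scope.

Section Dual.
Context {R : realType} (B : normedModType R).

Definition dual_pred : {pred (B -> R^o)} :=
  [pred f | `[< linear f /\ continuous f >]].

Lemma dual_predP (f : B -> R^o) :
  (f \in dual_pred) <-> (linear f /\ continuous f).
Proof. by split => [/asboolP//|h]; exact/asboolP. Qed.

Lemma dual_pred_submod : submod_closed dual_pred.
Proof.
split.
  apply/dual_predP; split; last by move=> x; exact: cst_continuous.
  by move=> a x y /=; rewrite /GRing.zero/= scaler0 addr0.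
move=> a f g /dual_predP[lf cf] /dual_predP[lg cg]; apply/dual_predP; split.
  move=> c x y.
  have E z : (a *: f + g) z = a *: f z + g z by [].
  rewrite !E lf lg !scalerDr !scalerA (mulrC a c).
  by rewrite addrACA.
move=> x.
apply: (@continuousD R R^o B (a *: f) g x); last exact: cg.
by apply: (@continuousZr _ _ _ f a x); exact: cf.
Qed.

HB.instance Definition _ :=
  GRing.isSubmodClosed.Build R (B -> R^o) dual_pred dual_pred_submod.

Record dual := Dual { dual_fun :> B -> R^o ; dual_funP : dual_fun \in dual_pred }.

HB.instance Definition _ := [isSub for dual_fun].
HB.instance Definition _ := [Choice of dual by <:].
HB.instance Definition _ := [SubChoice_isSubLmodule of dual by <:].

Lemma dual_linear (f : dual) : linear f.
Proof. by have /dual_predP[] := dual_funP f. Qed.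

Lemma dual_continuous (f : dual) : continuous f.
Proof. by have /dual_predP[] := dual_funP f. Qed.

HB.instance Definition _ (f : dual) :=
  GRing.isLinear.Build R B R^o *:%R (dual_fun f) (dual_linear f).

Definition dual_norm (f : dual) : R :=
  sup [set `|f x| | x in [set x : B | `|x| <= 1]].

Lemma dualDE (f g : dual) x : (f + g) x = f x + g x. Proof. by []. Qed.
Lemma dualZE a (f : dual) x : (a *: f) x = a * f x. Proof. by []. Qed.

Lemma dual_norm_has_sup (f : dual) :
  has_sup [set `|f x| | x in [set x : B | `|x| <= 1]].
Proof.
split; first by exists `|f 0|, 0 => //=; rewrite normr0.
have /bounded_funP /(_ 1) [M hM] : bounded_near f (nbhs (0 : B)).
  apply: (@continuous_linear_bounded R B R^o 0 f).
  exact: dual_continuous.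
by exists M => _ [x /= x1 <-]; exact: hM.
Qed.

Lemma le_dual_norm1 (f : dual) x : `|x| <= 1 -> `|f x| <= dual_norm f.
Proof.
by move=> x1; apply: sup_upper_bound; [exact: dual_norm_has_sup|exists x].
Qed.

Lemma dual_norm_le (f : dual) M :
  (forall x : B, `|x| <= 1 -> `|f x| <= M) -> dual_norm f <= M.
Proof.
move=> h; apply: sup_le_ub; first by case: (dual_norm_has_sup f).
by move=> _ [x /= x1 <-]; exact: h.
Qed.

Lemma dual_norm_ge0 (f : dual) : 0 <= dual_norm f.
Proof.
by apply: le_trans (@le_dual_norm1 f 0 _); rewrite ?normr0 ?ler01.
Qed.

Lemma ler_dual_normD (f g : dual) :
  dual_norm (f + g) <= dual_norm f + dual_norm g.
Proof.
apply: dual_norm_le => x x1; rewrite dualDE (le_trans (ler_normD _ _))//.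
by apply: lerD; exact: le_dual_norm1.
Qed.

Lemma dual_normZ (a : R) (f : dual) : dual_norm (a *: f) = `|a| * dual_norm f.
Proof.
have le c (g : dual) : dual_norm (c *: g) <= `|c| * dual_norm g.
  apply: dual_norm_le => x x1; rewrite dualZE normrM ler_wpM2l//.
  exact: le_dual_norm1.
apply/le_anti; rewrite le/=; have [->|a0] := eqVneq a 0.
  by rewrite normr0 mul0r dual_norm_ge0.
rewrite mulrC -ler_pdivlMr ?normr_gt0// mulrC -normfV.
by rewrite -[X in dual_norm X <= _](scalerK a0 f); exact: le.
Qed.

Lemma dual_norm0_eq0 (f : dual) : dual_norm f = 0 -> f = 0.
Proof.
move=> f0; apply/val_inj/funext => x /=.
have [->|x0] := eqVneq x 0; first by rewrite linear0.
have nx : `|x| != 0 by rewrite normr_eq0.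
have : `|f (`|x|^-1 *: x)| <= 0.
  rewrite -f0; apply: le_dual_norm1.
  by rewrite normrZ normfV normr_id mulVf.
rewrite normr_le0 linearZ/= scaler_eq0 invr_eq0 (negbTE nx)/=.
by move/eqP.
Qed.

HB.instance Definition _ :=
  Lmodule_isNormed.Build R dual ler_dual_normD dual_normZ dual_norm0_eq0.

Lemma dual_normE (f : dual) : `|f| = dual_norm f. Proof. by []. Qed.

End Dual.

Section Geometry.
Context {R : realType}.

(* Extended-real valued: the infimum over the empty set is +oo. *)
Definition convexity_constant (B : normedModType R) (q : R) : \bar R :=
  ereal_inf [set K%:E | K in [set K : R | 1 <= K /\ forall x y : B,
    2 * `|x| `^ q + 2 / K `^ q * `|y| `^ q <= `|x + y| `^ q + `|x - y| `^ q]].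

End Geometry.

Section Measurability.
Context {R : realType}.

Definition separable_set {V : topologicalType} (A : set V) :=
  exists S : set V, countable S /\ A `<=` closure S.

(* B need not be separable, so Borel measurability of vector-valued maps is
   complemented by separability of the range (Pettis). On a separable space
   the second condition is void. *)
Definition strongly_measurable {T : Type} {V : normedModType R}
    (G : set (set T)) (D : set T) (f : T -> V) :=
  (forall U, open U -> G (D `&` f @^-1` U)) /\ separable_set (f @` D).

Definition borel (V : normedModType R) := g_sigma_algebraType (@open V).

(* Joint measurability of (x, s) |-> g x s. For B separable this is Borel
   measurability on B * Xi with separable range (take S := setT). *)
Definition measurable_oracle {d} {Xi : measurableType d} {B V : normedModType R}
    (g : B -> Xi -> V) :=
  forall S : set B, closed S -> separable_set S ->
    strongly_measurable (@measurable _ (borel B * Xi)%type) (S `*` setT)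
      (fun z => g z.1 z.2).

End Measurability.

Section Probability.
Context {R : realType} {d : measure_display} {Omega : measurableType d}.
Variable P : probability Omega R.

Definition simple_map {V : normedModType R} (s : Omega -> V) :=
  finite_set (range s) /\ forall v, measurable (s @^-1` [set v]).

Definition simple_expectation {V : normedModType R} (s : Omega -> V) : V :=
  \sum_(v \in range s) fine (P (s @^-1` [set v])) *: v.

(* X is Bochner integrable with expectation z. *)
Definition has_expectation {V : normedModType R} (X : Omega -> V) (z : V) :=
  strongly_measurable (@measurable _ Omega) setT X /\
  exists s : nat -> Omega -> V,
    [/\ forall n, simple_map (s n),
        (fun n => 'E_P[(fun w => `|X w - s n w|)%R])%E @ \oo --> 0%E &
        (fun n => simple_expectation (s n)) @ \oo --> z].

Context {d' : measure_display} {Xi : measurableType d'}.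

Definition mutually_independent (I : set nat) (X : nat -> {RV P >-> Xi}) :=
  forall J : {fset nat}, [set` J] `<=` I ->
  forall A : nat -> set Xi, (forall j, measurable (A j)) ->
    P (\bigcap_(j in [set` J]) X j @^-1` A j) =
    (\prod_(j <- J) P (X j @^-1` A j))%E.

(* The copies are X 1, X 2, ...; X 0 is unused. *)
Definition independent_copies (X0 : {RV P >-> Xi}) (X : nat -> {RV P >-> Xi}) :=
  mutually_independent [set t | (1 <= t)%N] X /\
  forall t, (1 <= t)%N -> forall A, measurable A ->
    distribution P (X t) A = distribution P X0 A.

Definition history (X : nat -> {RV P >-> Xi}) (t : nat) : set (set Omega) :=
  <<s \bigcup_(s in [set s | (1 <= s <= t)%N])
        preimage_set_system setT (X s) measurable >>.

End Probability.

Section Algorithm.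
Context {R : realType} {d d' : measure_display}.
Context {Omega : measurableType d} {Xi : measurableType d'}.
Variable P : probability Omega R.
Context {B : normedModType R}.

Definition unit_ball_argmin (m : dual B) (v : B) :=
  `|v| <= 1 /\ forall e : B, `|e| <= 1 -> m v <= m e.

(* (x, m, dir) is a run of NSSD-M. The index 0 of x, dir, eta, beta is unused.
   The minimiser dir t is not unique where m t vanishes; the last clause says
   that it is chosen measurably from the samples seen so far
   (elsewhere uniform convexity makes this automatic). *)
Definition nssdm (g : B -> Xi -> dual B) (xi : nat -> {RV P >-> Xi})
    (x1 : B) (eta beta : nat -> R)
    (x : nat -> Omega -> B) (m : nat -> Omega -> dual B)
    (dir : nat -> Omega -> B) :=
  [/\ forall w, x 1%N w = x1,
      forall w, m 0%N w = g x1 (xi 1%N w),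
      forall t, (1 <= t)%N -> forall w,
        [/\ m t w = beta t *: m t.-1 w + (1 - beta t) *: g (x t w) (xi t w),
            unit_ball_argmin (m t w) (dir t w) &
            x t.+1 w = x t w + eta t *: dir t w] &
      forall t, (1 <= t)%N -> strongly_measurable (history xi t) setT (dir t)].

End Algorithm.

(* Main.v *)
Require Import Defs.
From HB Require Import structures.
From mathcomp Require Import all_boot all_order all_algebra finmap.
From mathcomp Require Import all_classical all_reals all_analysis.
From mathcomp Require Import measurable_realfun.
From mathcomp Require Import ring lra.
Set Implicit Arguments.
Unset Strict Implicit.
Import Order.TTheory GRing.Theory Num.Theory.
Import numFieldNormedType.Exports.
Local Open Scope classical_set_scope.
Local Open Scope ring_scope.

(** Write [a] for [1 - beta]. The direction [dir t] attains minus the norm of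
    [m t], so the descent lemma gives
      [eta |gradF (x t)| <= F (x t) - F (x t.+1) + 2 eta |m t - gradF (x t)|
       + L eta^2 / 2]   ([normalised_step]),
    and everything rests on the size of the momentum error [m t - gradF (x t)].
    Unrolling the momentum recursion ([momentum_error]) bounds it by three
    parts: the initial sampling error discounted by [(1 - a)^t], the drift of
    the gradient, at most [L eta (1 - a) / a], and the exponentially weighted
    sum [noise t] of the sampling errors, which is a martingale-like sum in the
    dual space.

    The last part is where the geometry enters. Duality turns the q-convexity
    inequality of the space into the p-smoothness inequality
      [|f + h|^p + |f - h|^p <= 2 |f|^p + 2 K^p |h|^p]
    of the dual norm ([dual_smooth]). If [h] is random with mean zero, Jensen's
    inequality gives [E |f - h|^p >= |f|^p], hence
    [E |f + h|^p <= |f|^p + 2 K^p E |h|^p] ([pnorm_step]). Each new sample is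
    independent of the history, and the past of the algorithm is measurable for
    the history, so by Tonelli's theorem the bound persists for a random past
    ([noise_step]). Iterating, [E |noise t|^p <= 2 K^p a^(p-1) sigma^p]
    ([noise_moment]), so that [E |noise t| <= 2 K sigma a^((p-1)/p)].

    Averaging over [t] leaves, up to constants,
      [sqrt (Delta1 L / (T a)) + sigma / (T a) + K sigma a^((p-1)/p)],
    and the prescribed [beta] balances these terms ([tuned_rate]). The infimum
    defining the convexity constant need not be attained by the definition
    alone; the slack in the numerical constants allows any admissible constant
    up to [2 K] in its place. *)

(** * Smoothness of the dual norm *)

Section UniformConvexity.
Context {R : realType} {B : normedModType R}.
Implicit Types f h : dual B.

Lemma dual_evalZ f (a : R) (x : B) : f (a *: x) = a * f x.
Proof. exact: linearZ. Qed.

Lemma ler_dual_norm f (x : B) : `|f x| <= `|f| * `|x|.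
Proof.
have [->|x0] := eqVneq x 0; first by rewrite linear0 !normr0 mulr0.
have nx : 0 < `|x| by rewrite normr_gt0.
rewrite -ler_pdivrMr// -(@gtr0_norm _ (`|x|^-1)) ?invr_gt0// mulrC -normrM.
rewrite -dual_evalZ dual_normE; apply: le_dual_norm1.
by rewrite normrZ gtr0_norm ?invr_gt0// mulVf// gt_eqF.
Qed.

Lemma dual_norm_sup f (c : R) : (forall x : B, `|x| <= 1 -> f x <= c) -> `|f| <= c.
Proof.
move=> h; rewrite dual_normE; apply: dual_norm_le => x x1.
by rewrite ler_norml h// andbT -lerNl -linearN h// normrN.
Qed.

Lemma argmin_dual_norm f (v : B) : unit_ball_argmin f v -> f v <= - `|f|.
Proof.
move=> [_ vmin]; rewrite lerNr; apply: dual_norm_sup => x x1.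
by rewrite lerNr -linearN; apply: vmin; rewrite normrN.
Qed.

Definition convex_with (q K : R) := forall x y : B,
  2 * `|x| `^ q + 2 / K `^ q * `|y| `^ q <= `|x + y| `^ q + `|x - y| `^ q.

(** Strict inequality in the infimum: a constant at most twice the infimum
    satisfies the convexity inequality. *)
Lemma convexity_constantP (q K : R) : convexity_constant B q = K%:E ->
  1 <= K /\ exists2 K', 1 <= K' <= 2 * K & convex_with q K'.
Proof.
move=> hK; have K1 : 1 <= K.
  rewrite -lee_fin -hK; apply: le_ereal_inf_tmp => _ [k [k1 _] <-].
  by rewrite lee_fin.
split=> //.
have : (convexity_constant B q < (2 * K)%:E)%E by rewrite hK lte_fin; lra.
move=> /ereal_inf_lt [_ [k [k1 hk] <-]]; rewrite lte_fin => kK.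
by exists k => //; rewrite k1 ltW.
Qed.

(** Young's inequality with weights chosen so that, in [dual_smooth], the term
    in the exponent [q] is absorbed without loss. *)
Lemma young_weighted (p q a b : R) : 1 < p -> q = p / (p - 1) -> 0 <= a -> 0 <= b ->
  a * b <= 2 * a `^ p / p + 2 * (b / 2) `^ q / q.
Proof.
move=> p1 -> a0 b0; have p0 : 0 < p by lra.
have q0 : 0 < p / (p - 1) by rewrite divr_gt0// subr_gt0.
have := @conjugate_powR R a (b / 2) p (p / (p - 1)) a0.
have b20 : 0 <= b / 2 by lra.
have pq : p^-1 + (p / (p - 1))^-1 = 1.
  by rewrite invf_div; field; lra.
move=> /(_ b20 p0 q0 pq); lra.
Qed.

(** Almost norming vectors [u], [v] of [f + h] and [f - h], scaled to
    [a = |f + h|^(p-1) u] and [b = |f - h|^(p-1) v], rewrite the left-hand side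
    as [f (a + b) + h (a - b)]. Young's inequality and the convexity inequality
    at [(a + b) / 2], [(a - b) / 2] bound this by [1 / p] times the right-hand
    side plus [1 / q] times the left-hand side. *)
Lemma dual_smooth (p q K : R) : 1 < p -> q = p / (p - 1) -> 1 <= K ->
  convex_with q K -> forall f h,
  `|f + h| `^ p + `|f - h| `^ p <= 2 * `|f| `^ p + 2 * K `^ p * `|h| `^ p.
Proof.
move=> p1 hq K1 hconv f h.
have [[c cE] [e eE]] : {c | c = `|f + h|} * {e | e = `|f - h|}.
  by split; eexists.
have c0 : 0 <= c by rewrite cE.
have e0 : 0 <= e by rewrite eE.
rewrite -cE -eE.
have q0 : 0 < q by rewrite hq divr_gt0// ; lra.
have K0 : 0 < K by lra.
have Kq0 : 0 < K `^ q by rewrite powR_gt0.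
have pow r : 0 <= r -> (r `^ (p - 1)) `^ q = r `^ p.
  move=> r0; rewrite -powRrM hq mulrC divfK//; lra.
have dbl (w : B) : w + w = 2 *: w by rewrite scaler_nat mulr2n.
have bnd (u v : B) : `|u| <= 1 -> `|v| <= 1 ->
    c `^ (p - 1) * (f + h) u + e `^ (p - 1) * (f - h) v <=
    (2 * `|f| `^ p + 2 * K `^ p * `|h| `^ p) / p + (c `^ p + e `^ p) / q.
  move=> u1 v1; set a := c `^ (p - 1) *: u; set b := e `^ (p - 1) *: v.
  pose y := 2^-1 *: (a + b); pose z := 2^-1 *: (a - b).
  have yz1 : y + z = a.
    rewrite /y /z -scalerDr addrACA subrr addr0 dbl.
    by rewrite (scalerA 2^-1) mulVf ?scale1r.
  have yz2 : y - z = b.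
    rewrite /y /z -scalerBr opprD opprK addrACA subrr add0r dbl.
    by rewrite (scalerA 2^-1) mulVf ?scale1r.
  have -> : c `^ (p - 1) * (f + h) u + e `^ (p - 1) * (f - h) v =
      f (y + y) + h (z + z).
    have -> : y + y = a + b by rewrite dbl (scalerA 2) mulfV ?scale1r.
    have -> : z + z = a - b by rewrite dbl (scalerA 2) mulfV ?scale1r.
    have -> : (f + h) u = f u + h u by [].
    have -> : (f - h) v = f v - h v by [].
    rewrite linearB linearD /a /b /= !dual_evalZ !mulrBr !mulrDr.
    by rewrite addrACA.
  have ha : `|a| `^ q <= c `^ p.
    rewrite -(pow c c0); apply: ge0_ler_powR; rewrite ?nnegrE//; first exact: ltW.
      exact: powR_ge0.
    by rewrite normrZ ger0_norm ?powR_ge0// ler_piMr// powR_ge0.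
  have hb : `|b| `^ q <= e `^ p.
    rewrite -(pow e e0); apply: ge0_ler_powR; rewrite ?nnegrE//; first exact: ltW.
      exact: powR_ge0.
    by rewrite normrZ ger0_norm ?powR_ge0// ler_piMr// powR_ge0.
  have := hconv y z; rewrite yz1 yz2 => hyz.
  have nyy (w : B) : `|w + w| = 2 * `|w| by rewrite dbl normrZ normr_nat.
  have f1 : f (y + y) <= 2 * `|f| `^ p / p + 2 * `|y| `^ q / q.
    have := @young_weighted p q `|f| `|y + y| p1 hq (normr_ge0 _) (normr_ge0 _).
    rewrite nyy (_ : 2 * `|y| / 2 = `|y|); last by field.
    apply: le_trans; rewrite -nyy.
    exact: le_trans (ler_norm _) (ler_dual_norm _ _).
  have f2 : h (z + z) <= 2 * (K `^ p * `|h| `^ p) / p + 2 * (`|z| `^ q / K `^ q) / q.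
    have := @young_weighted p q (K * `|h|) (`|z + z| / K) p1 hq.
    rewrite (mulr_ge0 (ltW K0))// divr_ge0 ?(ltW K0)// => /(_ isT isT).
    rewrite nyy (_ : 2 * `|z| / K / 2 = `|z| / K); last by field; lra.
    rewrite (_ : K * `|h| * (2 * `|z| / K) = `|h| * (2 * `|z|)); last by field; lra.
    rewrite (powRM _ (ltW K0))// powRM ?invr_ge0 ?(ltW K0)//.
    rewrite -(powR_inv1 (ltW K0)) -powRrM mulN1r powRN.
    apply: le_trans; rewrite -nyy.
    exact: le_trans (ler_norm _) (ler_dual_norm _ _).
  have hyz2 : (2 * `|y| `^ q + 2 / K `^ q * `|z| `^ q) / q <= (c `^ p + e `^ p) / q.
    by rewrite ler_pM2r ?invr_gt0//; lra.
  by move: f1 f2 hyz2; lra.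
have p0 : 0 < p by lra.
have qV : q^-1 = 1 - p^-1 by rewrite hq invf_div; field; lra.
set W := 2 * `|f| `^ p + 2 * K `^ p * `|h| `^ p in bnd *.
have powS r : 0 <= r -> r `^ (p - 1) * r = r `^ p.
  by move=> r0; rewrite mulrC mulr_powRB1.
(* optimise over the two unit vectors in turn *)
have bnd1 (v : B) : `|v| <= 1 ->
    c `^ p + e `^ (p - 1) * (f - h) v <= W / p + (c `^ p + e `^ p) / q.
  move=> v1; rewrite -lerBrDr; rewrite -[c `^ p in X in X <= _]powS//.
  have : `|c `^ (p - 1) *: (f + h)| <= W / p + (c `^ p + e `^ p) / q - e `^ (p - 1) * (f - h) v.
    apply: dual_norm_sup => u u1; have := bnd u v u1 v1.
    by rewrite dualZE; lra.
  by rewrite normrZ ger0_norm ?powR_ge0// -cE.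
have : `|e `^ (p - 1) *: (f - h)| <= W / p + (c `^ p + e `^ p) / q - c `^ p.
  apply: dual_norm_sup => v v1; have := bnd1 v v1.
  by rewrite dualZE; lra.
rewrite normrZ ger0_norm ?powR_ge0// -eE powS// qV => hfin.
have : (c `^ p + e `^ p) / p <= W / p by lra.
by rewrite ler_pM2r// invr_gt0.
Qed.

End UniformConvexity.

(** * Descent *)

Section Descent.
Context {R : realType} {B : normedModType R}.
Variables (F : B -> R^o) (gradF : B -> dual B) (L : R).
Hypothesis hF : forall x : B, is_diff x F (gradF x).
Hypothesis lipF : forall x y : B, `|gradF x - gradF y| <= L * `|x - y|.

(** Along the segment, [F (x + s h)] minus the claimed upper bound has a
    nonpositive derivative in [s] by the Lipschitz condition. *)
Lemma descent (x h : B) : F (x + h) <= F x + gradF x h + L / 2 * `|h| ^+ 2.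
Proof.
pose psi (s : R) : R := F (x + s *: h) - s * gradF x h - L / 2 * s ^+ 2 * `|h| ^+ 2.
pose dpsi (s : R) : R := gradF (x + s *: h) h - gradF x h - L * s * `|h| ^+ 2.
have line (s : R) : is_derive s (1 : R) (fun s : R => F (x + s *: h) : R)
    (gradF (x + s *: h) h).
  have Hl : is_diff (s : R) (fun s : R => x + s *: h) (fun r : R => r *: h).
    by apply: is_diff_eq; rewrite add0r.
  have Hc : is_diff (s : R) (F \o (fun s : R => x + s *: h))
      (gradF (x + s *: h) \o (fun r : R => r *: h)) by exact: is_diff_comp.
  have dc : differentiable (F \o (fun s : R => x + s *: h)) (s : R).
    exact: ex_diff.
  apply: DeriveDef; first exact: diff_derivable.
  by rewrite deriveE// diff_val /= scale1r.
have dpsiP (s : R) : is_derive s (1 : R) psi (dpsi s).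
  rewrite /psi /dpsi; apply: is_derive_eq.
  by move: (gradF (x + s *: h) h : R) => r; rewrite /GRing.scale/= ; field.
have psicont : {within `[0, 1], continuous psi}.
  apply: continuous_subspaceT => s.
  by apply: differentiable_continuous; apply/derivable1_diffP; exact: ex_derive.
have [c c01 hc] := MVT ltr01 (fun s _ => dpsiP s) psicont.
have c0 : 0 < c by move: c01; rewrite in_itv => /andP[].
have psi0 : psi 0 = F x by rewrite /psi scale0r addr0; lra.
have psi1 : psi 1 = F (x + h) - gradF x h - L / 2 * `|h| ^+ 2.
  by rewrite /psi scale1r; lra.
have : dpsi c <= 0.
  rewrite /dpsi subr_le0 (_ : _ - _ = (gradF (x + c *: h) - gradF x) h)//.
  apply: le_trans (ler_norm _) _; apply: le_trans (ler_dual_norm _ _) _.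
  rewrite expr2 mulrA ler_wpM2r//; apply: le_trans (lipF _ _) _.
  by rewrite addrC addKr normrZ gtr0_norm// mulrA.
by rewrite subr0 mulr1 in hc; lra.
Qed.

(** A step of length [|gradF x| / L] along a nearly norming direction would
    decrease [F] by nearly [|gradF x|^2 / (2 L)]. *)
Lemma minimiser_gradient0 (x : B) : 0 < L -> (forall y, F x <= F y) -> gradF x = 0.
Proof.
move=> L0 xmin; apply/eqP; rewrite -normr_le0 leNgt; apply/negP => n0.
set n := `|gradF x| in n0 *; have r0 : 0 < n / L by rewrite divr_gt0.
have : n <= L / 2 * (n / L).
  apply: dual_norm_sup => e e1.
  have := le_trans (xmin _) (descent x ((n / L) *: - e)).
  rewrite dual_evalZ linearN normrZ normrN (gtr0_norm r0) => h.
  have : `|e| ^+ 2 <= 1 by rewrite expr_le1.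
  rewrite -(ler_pM2l (mulr_gt0 (divr_gt0 L0 (ltr0n _ 2)) (exprn_gt0 2 r0))) mulr1.
  rewrite exprMn mulrA in h => h2.
  rewrite -(ler_pM2l r0); move: h h2; rewrite /=; lra.
rewrite (_ : L / 2 * (n / L) = n / 2); last by field; lra.
lra.
Qed.

(** The argmin direction satisfies [m v = - |m|], and replacing [m] by [gradF x]
    costs [|m - gradF x|] twice: in the pairing with [v] and in the norm. *)
Lemma normalised_step (x v : B) (m : dual B) (eta : R) : 0 <= L -> 0 <= eta ->
  unit_ball_argmin m v ->
  eta * `|gradF x| <=
    F x - F (x + eta *: v) + 2 * eta * `|m - gradF x| + L / 2 * eta ^+ 2.
Proof.
move=> L0 eta0 mv; have [v1 _] := mv.
have := descent x (eta *: v); rewrite dual_evalZ normrZ (ger0_norm eta0).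
have h1 : (gradF x - m) v <= `|m - gradF x|.
  rewrite -normrN opprB; apply: le_trans (ler_norm _) _.
  by apply: le_trans (ler_dual_norm _ _) _; rewrite ler_piMr.
have h2 := argmin_dual_norm mv.
have h3 : `|gradF x| <= `|m| + `|m - gradF x|.
  by rewrite -[X in `|X| <= _](subrK m) addrC (distrC m) ler_normD.
have h4 : gradF x v = m v + (gradF x - m) v by rewrite -dualDE addrC subrK.
have h5 : (eta * `|v|) ^+ 2 <= eta ^+ 2.
  by rewrite exprMn ler_piMr ?sqr_ge0// expr_le1.
have h6 : eta * gradF x v <= eta * (2 * `|m - gradF x| - `|gradF x|).
  by rewrite ler_wpM2l//; lra.
have h7 : L / 2 * (eta * `|v|) ^+ 2 <= L / 2 * eta ^+ 2.
  by rewrite ler_wpM2l// divr_ge0.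
lra.
Qed.

End Descent.

(** * Strongly measurable maps *)

Section StrongMeasurability.
Context {R : realType} {d : measure_display} {T : measurableType d}.

Lemma separable_setP (V : normedModType R) (A : set V) :
  separable_set A <-> exists s : nat -> V, A `<=` closure (range s).
Proof.
split=> [[S [/pcard_surjP[s sS] AS]]|[s As]].
  exists s; apply: subset_trans AS _; apply: closureS.
  by move=> v /sS[n _ <-]; exists n.
exists (range s); split => //; apply: sub_countable (countableP [set: nat]).
exact: card_image_le.
Qed.

Lemma separable_set_sub (V : normedModType R) (A A' : set V) :
  A `<=` A' -> separable_set A' -> separable_set A.
Proof.
by move=> AA' [S [cS SA]]; exists S; split => //; exact: subset_trans SA.
Qed.

Definition smeas (V : normedModType R) (f : T -> V) :=
  strongly_measurable (@measurable d T) setT f.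

Lemma smeas_cst (V : normedModType R) (v : V) : smeas (fun=> v).
Proof.
split=> [U _|].
  by rewrite setTI preimage_cst; case: ifP.
apply/separable_setP; exists (fun=> v) => _ [t _ <-].
by apply: subset_closure; exists 0%N.
Qed.

(** Separability of both ranges makes the preimage of an open set a countable
    union of sets [f1^-1 (ball) & f2^-1 (ball)], although the Borel sigma-algebra
    of the product may be larger than the product sigma-algebra. This is what
    makes sums and differences of strongly measurable maps measurable. *)
Lemma smeas_comp2 (V1 V2 W : normedModType R) (h : V1 * V2 -> W)
    (f1 : T -> V1) (f2 : T -> V2) :
  continuous h -> smeas f1 -> smeas f2 -> smeas (fun t => h (f1 t, f2 t)).
Proof.
move=> ch [mf1 /separable_setP[s1 hs1]] [mf2 /separable_setP[s2 hs2]].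
have rad n : 0 < n.+1%:R^-1 :> R by rewrite invr_gt0.
have near1 t (e : R) : 0 < e -> exists i, ball (f1 t) e (s1 i).
  move=> e0; have [] := hs1 (f1 t) _ (ball (f1 t) e); first by exists t.
    exact: nbhsx_ballx.
  by move=> _ [[i _ <-] bi]; exists i.
have near2 t (e : R) : 0 < e -> exists i, ball (f2 t) e (s2 i).
  move=> e0; have [] := hs2 (f2 t) _ (ball (f2 t) e); first by exists t.
    exact: nbhsx_ballx.
  by move=> _ [[i _ <-] bi]; exists i.
have cover t (U : set W) : nbhs (h (f1 t, f2 t)) U -> exists2 e : R, 0 < e &
    forall a b, ball (f1 t) e a -> ball (f2 t) e b -> U (h (a, b)).
  move=> /ch /nbhs_ballP[e /= e0 he]; exists e => // a b ha hb.
  exact: (he (a, b)).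
split=> [U oU|].
  pose good (k : nat * nat * nat) := forall a b,
    ball (s1 k.1.1) k.2.+1%:R^-1 a -> ball (s2 k.1.2) k.2.+1%:R^-1 b -> U (h (a, b)).
  pose piece (k : nat * nat * nat) : set T := if `[< good k >] then
    f1 @^-1` ball (s1 k.1.1) k.2.+1%:R^-1 `&` f2 @^-1` ball (s2 k.1.2) k.2.+1%:R^-1
    else set0.
  rewrite setTI (_ : _ @^-1` _ = \bigcup_k piece k); last first.
    apply/seteqP; split=> [t /= Ut|t [k _]]; last first.
      by rewrite /piece; case: asboolP => // gk [/= b1 b2]; exact: gk.
    have [e e0 he] := cover t U (open_nbhs_nbhs (conj oU Ut)).
    have e20 : 0 < e / 2 by exact: divr_gt0.
    have [n _ ne] := near_infty_natSinv_lt (PosNum e20).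
    have {}ne : n.+1%:R^-1 <= e / 2 by exact/ltW/(ne n (leqnn n)).
    have [i hi] := near1 t _ (rad n); have [j hj] := near2 t _ (rad n).
    exists (i, j, n) => //; rewrite /piece; case: asboolP => [_|].
      by split; apply: ball_sym.
    case=> a b /= ha hb; apply: he.
      apply: (@le_ball _ _ _ (n.+1%:R^-1 + n.+1%:R^-1)); first by rewrite [leRHS]splitr lerD.
      exact: ball_triangle ha.
    apply: (@le_ball _ _ _ (n.+1%:R^-1 + n.+1%:R^-1)); first by rewrite [leRHS]splitr lerD.
    exact: ball_triangle hb.
  apply: countable_bigcupT_measurable; first exact: countableP.
  move=> k; rewrite /piece; case: asboolP => // _; apply: measurableI.
    by have := mf1 _ (ball_open (s1 k.1.1) k.2.+1%:R^-1); rewrite setTI.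
  by have := mf2 _ (ball_open (s2 k.1.2) k.2.+1%:R^-1); rewrite setTI.
exists (range (fun k : nat * nat => h (s1 k.1, s2 k.2))); split.
  by apply: sub_countable (countableP [set: nat * nat]); exact: card_image_le.
move=> _ [t _ <-] U /cover[e e0 he].
have [i hi] := near1 t _ e0; have [j hj] := near2 t _ e0.
by exists (h (s1 i, s2 j)); split; [exists (i, j)|exact: he].
Qed.

Lemma smeas_comp (V W : normedModType R) (h : V -> W) (f : T -> V) :
  continuous h -> smeas f -> smeas (fun t => h (f t)).
Proof.
move=> ch mf; apply: (smeas_comp2 (h := fun z : V * V => h z.1) _ mf mf) => z.
by apply: (@continuous_comp _ _ _ fst h); [exact: cvg_fst|exact: ch].
Qed.

Lemma smeasD (V : normedModType R) (f1 f2 : T -> V) :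
  smeas f1 -> smeas f2 -> smeas (fun t => f1 t + f2 t).
Proof.
by apply: (@smeas_comp2 _ _ _ (fun z : V * V => z.1 + z.2)); exact: add_continuous.
Qed.

Lemma smeasB (V : normedModType R) (f1 f2 : T -> V) :
  smeas f1 -> smeas f2 -> smeas (fun t => f1 t - f2 t).
Proof.
by apply: (@smeas_comp2 _ _ _ (fun z : V * V => z.1 - z.2)); exact: sub_continuous.
Qed.

Lemma smeasZ (V : normedModType R) (a : R) (f : T -> V) :
  smeas f -> smeas (fun t => a *: f t).
Proof. by apply: smeas_comp; exact: scaler_continuous. Qed.

Lemma measurable_smeas_norm (V : normedModType R) (f : T -> V) :
  smeas f -> measurable_fun setT (fun t => `|f t|).
Proof.
move=> /(smeas_comp (@norm_continuous _ V))[mf _].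
apply: (measurability _ (RGenOpens.measurableE R)) => _ [_ [a [b ->]] <-].
by apply: mf; exact: interval_open.
Qed.

Lemma smeas_measurable_borel (V : normedModType R) (f : T -> V) :
  smeas f -> measurable_fun setT (f : T -> borel V).
Proof.
move=> [mf _]; apply: (@measurability _ _ T (borel V) setT f (@open V)) => // _ [U oU <-].
exact: mf.
Qed.

(** The closure of the range of [X] is a closed separable set, to which the joint
    measurability of the oracle applies. *)
Lemma smeas_oracle d' (Xi : measurableType d') (B V : normedModType R)
    (g : B -> Xi -> V) (X : T -> B) (z : T -> Xi) :
  measurable_oracle g -> smeas X -> measurable_fun setT z ->
  smeas (fun t => g (X t) (z t)).
Proof.
move=> mg mX mz; have [S [cS XS]] := mX.2.
have sepS : separable_set (closure S) by exists S; split.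
have [mgU sepg] := mg (closure S) (@closed_closure _ _) sepS; split=> [U oU|]; last first.
  apply: separable_set_sub sepg => _ [t _ <-]; exists (X t, z t) => //.
  by split => //; apply: XS; exists t.
have mXz : measurable_fun setT (fun t => (X t : borel B, z t)).
  by apply: measurable_fun_pair => //; exact: smeas_measurable_borel.
have := mXz measurableT _ (mgU U oU); rewrite !setTI.
congr measurable; apply/seteqP; split=> t /=; first by case.
by move=> Ut; split => //; split => //; apply: XS; exists t.
Qed.

End StrongMeasurability.

Lemma smeas_precomp (R : realType) d d' (T : measurableType d)
    (T' : measurableType d') (V : normedModType R) (f : T -> V) (u : T' -> T) :
  measurable_fun setT u -> smeas f -> smeas (fun t => f (u t)).
Proof.
move=> mu [mf sf]; split=> [U oU|].
  have /mu := mf U oU; rewrite !setTI; exact.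
by apply: separable_set_sub sf => _ [t _ <-]; exists (u t).
Qed.

(** * Expectations of nonnegative functions *)

Section NonnegativeExpectation.
Context {R : realType} {d : measure_display} {Omega : measurableType d}.
Variable P : probability Omega R.
Implicit Types X Y : Omega -> R.
Local Open Scope ereal_scope.

Lemma expectation_ge0_le X Y :
  measurable_fun setT X -> measurable_fun setT Y ->
  (forall w, 0 <= X w)%R -> (forall w, X w <= Y w)%R -> 'E_P[X] <= 'E_P[Y].
Proof.
move=> mX mY X0 XY; apply: expectation_le => //; last exact: aeW.
by move=> w; exact: le_trans (XY w).
Qed.

Lemma expectation_ge0D X Y :
  measurable_fun setT X -> measurable_fun setT Y ->
  (forall w, 0 <= X w)%R -> (forall w, 0 <= Y w)%R ->
  'E_P[(fun w => X w + Y w)%R] = 'E_P[X] + 'E_P[Y].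
Proof.
move=> mX mY X0 Y0; rewrite unlock; under eq_integral do rewrite EFinD.
by rewrite ge0_integralD//=; try (by move=> w _; rewrite lee_fin); exact/measurable_EFinP.
Qed.

Lemma expectation_ge0Z X (a : R) : (0 <= a)%R ->
  measurable_fun setT X -> (forall w, 0 <= X w)%R ->
  'E_P[(fun w => a * X w)%R] = a%:E * 'E_P[X].
Proof.
move=> a0 mX X0; rewrite unlock; under eq_integral do rewrite EFinM.
rewrite ge0_integralZl_EFin//; last exact/measurable_EFinP.
by move=> w _; rewrite lee_fin.
Qed.

Lemma expectation_const (a : R) : 'E_P[(fun=> a)] = a%:E.
Proof. exact: expectation_cst. Qed.

Lemma expectation_ge0_sum (I : Type) (s : seq I) (X : I -> Omega -> R) :
  (forall i, measurable_fun setT (X i)) -> (forall i w, 0 <= X i w)%R ->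
  'E_P[(fun w => \sum_(i <- s) X i w)%R] = \sum_(i <- s) 'E_P[X i].
Proof.
move=> mX X0; rewrite unlock; under eq_integral do rewrite -sumEFin.
rewrite ge0_integral_sum//; first by move=> i; exact/measurable_EFinP.
by move=> i w _; rewrite lee_fin.
Qed.

(** Integrate Young's inequality [a^(p-1) X <= X^p / p + (1 - 1/p) a^p]. *)
Lemma expectation_le_pnorm X (p a : R) : (1 < p)%R -> (0 < a)%R ->
  measurable_fun setT X -> (forall w, 0 <= X w)%R ->
  'E_P[(fun w => X w `^ p)%R] <= (a `^ p)%:E -> 'E_P[X] <= a%:E.
Proof.
move=> p1 a0 mX X0 hX.
have mXp : measurable_fun setT (fun w => X w `^ p)%R.
  by apply: (measurableT_comp (measurable_powR p)).
have p0 : (0 < p)%R by lra.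
have ap0 : (0 < a `^ (p - 1))%R by rewrite powR_gt0.
have young w : (a `^ (p - 1) * X w <= p^-1 * X w `^ p + (1 - p^-1) * a `^ p)%R.
  have q0 : (0 < p / (p - 1))%R by rewrite divr_gt0// subr_gt0.
  have pq : (p^-1 + (p / (p - 1))^-1 = 1)%R by rewrite invf_div; field; lra.
  have := @conjugate_powR R (X w) (a `^ (p - 1))%R p (p / (p - 1))%R
    (X0 w) (ltW ap0) p0 q0 pq.
  rewrite -powRrM [((p - 1) * _)%R]mulrC divfK; last lra.
  rewrite [(X w * _)%R]mulrC.
  by rewrite (_ : (p / (p - 1))^-1 = 1 - p^-1)%R//; lra.
have pV : (0 <= p^-1)%R by rewrite invr_ge0 ltW.
have pV1 : (0 <= 1 - p^-1)%R by rewrite subr_ge0 invf_le1// ltW.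
have : (a `^ (p - 1))%:E * 'E_P[X] <= (a `^ p)%:E.
  rewrite -expectation_ge0Z ?(ltW ap0)//.
  apply: (@le_trans _ _ 'E_P[(fun w => p^-1 * X w `^ p + (1 - p^-1) * a `^ p)%R]).
    apply: expectation_ge0_le => //.
    - exact: measurable_funM.
    - by apply: measurable_funD => //; exact: measurable_funM.
    - by move=> w; rewrite mulr_ge0// ltW.
  rewrite expectation_ge0D//; last 3 first.
    - exact: measurable_funM.
    - by move=> w; rewrite mulr_ge0// powR_ge0.
    - by move=> w; rewrite mulr_ge0// powR_ge0.
  rewrite expectation_const expectation_ge0Z//; last by move=> w; exact: powR_ge0.
  have h : (p^-1)%:E * 'E_P[(fun w => X w `^ p)%R] <= (p^-1 * a `^ p)%:E.
    by rewrite EFinM lee_wpmul2l.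
  apply: le_trans (leeD2r _ h) _; rewrite -EFinD lee_fin.
  by rewrite mulrBl mul1r addrC subrK.
rewrite -lee_pdivlMl// => /le_trans; apply; rewrite -EFinM lee_fin.
by rewrite ler_pdivrMl// mulrC mulr_powRB1// ltW.
Qed.

End NonnegativeExpectation.

(** * Jensen's inequality for Bochner expectations *)

Section BochnerExpectation.
Context {R : realType} {d : measure_display} {Omega : measurableType d}.
Variable P : probability Omega R.
Context {V : normedModType R}.
Implicit Types (s X : Omega -> V).

Lemma simple_map_smeas s : simple_map s -> smeas s.
Proof.
move=> [fs ms]; split=> [U _|].
  rewrite setTI (_ : s @^-1` U = \bigcup_(v in range s `&` U) s @^-1` [set v]).
    by apply: fin_bigcup_measurable => //; exact: finite_setIl.
  apply/seteqP; split=> [w Uw|w [v [_ Uv] /= ->]//].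
  by exists (s w) => //; split => //; exists w.
exists (range s); split; last exact: subset_closure.
exact: finite_set_countable.
Qed.

Lemma simple_expectation_comp s (phi : V -> R) : simple_map s ->
  (forall v, 0 <= phi v) ->
  'E_P[(fun w => phi (s w))]%E =
  (\sum_(v \in range s) phi v * fine (P (s @^-1` [set v])))%:E.
Proof.
move=> [fs ms] phi0.
have decomp w : phi (s w) = \sum_(v \in range s) phi v * \1_(s @^-1` [set v]) w.
  rewrite (fsbigD1 (s w))/=; last 2 first.
    - exact: sub_finite_set fs.
    - by exists w.
  rewrite indicE mem_set// mulr1 fsbig1 ?addr0// => v [_ /= vs].
  by rewrite indicE memNset ?mulr0// => /= sv; apply: vs; rewrite sv.
rewrite unlock; under eq_integral do rewrite decomp -fsumEFin//.
rewrite ge0_integral_fsum//; last 2 first.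
- move=> v; apply/measurable_EFinP; apply: measurable_funM => //.
- by move=> v w _; rewrite lee_fin mulr_ge0// indicE ler0n.
rewrite -fsumEFin//; apply: eq_fsbigr => v _.
under eq_integral do rewrite EFinM.
rewrite ge0_integralZl_EFin//; last by apply/measurable_EFinP; exact: measurable_indic.
by rewrite integral_indic// setIT EFinM fineK // fin_num_measure.
Qed.

Lemma simple_expectation_norm s (c : V) : simple_map s ->
  (`|simple_expectation P s - c|%:E <= 'E_P[(fun w => `|s w - c|%R)])%E.
Proof.
move=> hs; have [fs _] := hs.
have total : \sum_(v \in range s) fine (P (s @^-1` [set v])) = 1.
  apply: EFin_inj; rewrite -(expectation_const P 1).
  rewrite (@simple_expectation_comp s (fun=> 1))//; congr EFin.
  by apply: eq_fsbigr => v _; rewrite mul1r.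
rewrite (@simple_expectation_comp s (fun v => `|v - c|))// lee_fin.
rewrite -[X in _ - X]scale1r -total /simple_expectation.
rewrite !fsbig_finite//= scaler_suml -sumrB; apply: le_trans (ler_norm_sum _ _ _) _.
apply: ler_sum => v _; rewrite -scalerBr normrZ mulrC ger0_norm//.
exact: fine_ge0.
Qed.

(** The triangle inequality for finite sums passes from simple maps to their
    limits. *)
Lemma has_expectation_norm X (z c : V) : has_expectation P X z ->
  (`|z - c|%:E <= 'E_P[(fun w => `|X w - c|%R)])%E.
Proof.
move=> [mX [s [ss Xs sz]]].
have mXc : measurable_fun setT (fun w => `|X w - c|).
  by apply/measurable_smeas_norm/smeasB => //; exact: smeas_cst.
apply/lee_addgt0Pr => e e0; have e20 : 0 < e / 2 by rewrite divr_gt0.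
have [n [Xn zn]] : exists n, ('E_P[(fun w => `|X w - s n w|%R)] <= (e / 2)%:E)%E
    /\ `|simple_expectation P (s n) - z| <= e / 2.
  have near1 : \forall n \near \oo, ('E_P[(fun w => `|X w - s n w|%R)] <= (e / 2)%:E)%E.
    move/fine_cvgP : Xs => [finX /cvgrPdist_le /(_ _ e20)] h.
    near=> n.
    have finn : 'E_P[(fun w => `|X w - s n w|%R)]%E \is a fin_num by near: n.
    rewrite -(fineK finn) lee_fin; apply: le_trans (ler_norm _) _.
    by rewrite -normrN -sub0r; near: n.
  have near2 : \forall n \near \oo, `|simple_expectation P (s n) - z| <= e / 2.
    by move/cvgrPdist_le : sz => /(_ _ e20); apply: filterS => n; rewrite distrC.
  near \oo => n; exists n; split; [near: n; exact: near1|near: n; exact: near2].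
have msn := simple_map_smeas (ss n).
have step : ('E_P[(fun w => `|s n w - c|%R)] <=
    'E_P[(fun w => `|X w - c|%R)] + 'E_P[(fun w => `|X w - s n w|%R)])%E.
  have mXs : measurable_fun setT (fun w => `|X w - s n w|).
    exact/measurable_smeas_norm/smeasB.
  rewrite -expectation_ge0D//; apply: expectation_ge0_le => //.
  - by apply/measurable_smeas_norm/smeasB => //; exact: smeas_cst.
  - exact: measurable_funD.
  - by move=> w; rewrite [leRHS]addrC (distrC (X w)); exact: ler_distD.
apply: (@le_trans _ _ (`|simple_expectation P (s n) - c|%:E + (e / 2)%:E)%E).
  rewrite -EFinD lee_fin [leRHS]addrC.
  by apply: le_trans (ler_distD (simple_expectation P (s n)) _ _) _; rewrite lerD2r distrC.
apply: (@le_trans _ _ ('E_P[(fun w => `|s n w - c|%R)] + (e / 2)%:E)%E).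
  by rewrite leeD2r// simple_expectation_norm.
rewrite [in leRHS](splitr e) EFinD addeA leeD2r//.
by apply: le_trans step _; rewrite leeD2l.
Unshelve. all: by end_near. Qed.

(** Were the right-hand side smaller, [expectation_le_pnorm] with an
    intermediate constant would contradict [has_expectation_norm]. *)
Lemma has_expectation_pnorm X (z c : V) (p : R) : 1 < p -> has_expectation P X z ->
  ((`|z - c| `^ p)%:E <= 'E_P[(fun w => `|X w - c| `^ p)%R])%E.
Proof.
move=> p1 hX; have [mX _] := hX; have p0 : 0 < p by lra.
have mXc : measurable_fun setT (fun w => `|X w - c|).
  by apply/measurable_smeas_norm/smeasB => //; exact: smeas_cst.
rewrite leNgt; apply/negP => hlt.
set E := 'E_P[_]%E in hlt; have E0 : (0 <= E)%E by apply: expectation_ge0 => w; exact: powR_ge0.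
have Efin : E \is a fin_num by rewrite ge0_fin_numE// (lt_trans hlt)// ltry.
have fE0 : 0 <= fine E by exact: fine_ge0.
have fE : fine E < `|z - c| `^ p by rewrite -lte_fin fineK.
pose b := ((fine E + `|z - c| `^ p) / 2) `^ p^-1.
have mid0 : 0 < (fine E + `|z - c| `^ p) / 2 by lra.
have b0 : 0 < b by rewrite powR_gt0.
have bp : b `^ p = (fine E + `|z - c| `^ p) / 2.
  by rewrite /b -powRrM mulVf ?gt_eqF// powRr1 ?ltW.
have : ('E_P[(fun w => `|X w - c|%R)] <= b%:E)%E.
  apply: (expectation_le_pnorm p1 b0 mXc) => //.
  by rewrite -/E -(fineK Efin) lee_fin bp; lra.
move/(le_trans (has_expectation_norm c hX)); rewrite lee_fin => zb.
have : `|z - c| `^ p <= b `^ p by apply: ge0_ler_powR; rewrite ?nnegrE// ltW.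
by rewrite bp; lra.
Qed.

End BochnerExpectation.

(** * Independence of the next sample *)

Section Independence.
Context {R : realType} {d d' : measure_display}.
Context {Omega : measurableType d} {Xi : measurableType d'}.
Variable P : probability Omega R.

Implicit Types X : nat -> {RV P >-> Xi}.

Definition history_gen (X : nat -> {RV P >-> Xi}) (k : nat) : set (set Omega) :=
  \bigcup_(s in [set s | (1 <= s <= k)%N])
    preimage_set_system setT (X s) measurable.

(** The sample space with the sigma-algebra [history X k], so that measurability
    with respect to the past is measurability on this type. *)
Definition historyT (X : nat -> {RV P >-> Xi}) (k : nat) :=
  g_sigma_algebraType (history_gen X k).

Lemma history_measurable X k A : history X k A -> measurable A.
Proof.
apply: smallest_sub; first exact: sigma_algebra_measurable.
move=> _ [s _ [C mC <-]].
by rewrite setTI; exact: measurable_sfunP.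
Qed.

Lemma historyS X k : history X k `<=` history X k.+1.
Proof.
apply: smallest_sub; first exact: smallest_sigma_algebra.
move=> A [s /= /andP[s1 sk] hA]; apply: sub_sigma_algebra; exists s => //=.
by rewrite s1 (leq_trans sk).
Qed.

Lemma history_last X k C : measurable C -> history X k.+1 (X k.+1 @^-1` C).
Proof.
move=> mC; apply: sub_sigma_algebra; exists k.+1 => /=; first by rewrite leqnn.
by exists C => //; rewrite setTI.
Qed.

(** Both sides are finite measures in [A]. They agree on the cylinders
    [X_1 in A_1, ..., X_k in A_k] by mutual independence, and these are stable
    under intersection and generate the history. *)
Lemma history_independent X k A C :
  mutually_independent [set t | (1 <= t)%N] X -> measurable C -> history X k A ->
  (P (A `&` X k.+1 @^-1` C) = P A * P (X k.+1 @^-1` C))%E.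
Proof.
move=> indX mC hA.
pose J := [fset j | j in iota 1 k]%fset.
have JP j : (j \in J) = (1 <= j <= k)%N.
  by rewrite !inE /= mem_iota add1n ltnS.
pose cyl (A : nat -> set Xi) := \bigcap_(j in [set` J]) X j @^-1` A j.
pose G := [set cyl A | A in [set A : nat -> set Xi | forall j, measurable (A j)]].
have mpre j (D : set Xi) : measurable D -> measurable (X j @^-1` D).
  by move=> mD; exact: measurable_sfunP.
have mG : G `<=` measurable.
  move=> _ [D mD <-]; apply: fin_bigcap_measurable => // j _; exact: mpre.
have GI : setI_closed G.
  move=> _ _ [D mD <-] [D' mD' <-]; exists (fun j => D j `&` D' j).
    by move=> j; exact: measurableI.
  by rewrite /cyl -bigcapI; apply: eq_bigcapr => j _; rewrite preimage_setI.
have GT : G setT.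
  by exists (fun=> setT) => //; rewrite /cyl; apply/seteqP; split.
have sub : history X k `<=` <<s G >>.
  apply: smallest_sub; first exact: smallest_sigma_algebra.
  move=> _ [s /= sk [D mD <-]]; apply: sub_sigma_algebra.
  exists (fun j => if j == s then D else setT).
    by move=> j; case: ifP.
  rewrite setTI /cyl; apply/seteqP; split=> [w /(_ s)|w Dw j _ /=].
    by rewrite eqxx /=; apply; rewrite /= JP.
  by case: eqP => // ->.
have PC : (P (X k.+1 @^-1` C) = (fine (P (X k.+1 @^-1` C)))%:E)%E.
  by rewrite fineK// fin_num_measure//; exact: mpre.
have c0 : 0 <= fine (P (X k.+1 @^-1` C)) by exact: fine_ge0.
pose m1 : {measure set Omega -> \bar R} := mrestr P (mpre k.+1 _ mC).
pose m2 : {measure set Omega -> \bar R} := mscale (NngNum c0) P.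
have -> : P (A `&` X k.+1 @^-1` C) = m1 A by [].
have m2E B : (m2 B = P B * P (X k.+1 @^-1` C))%E by rewrite muleC {1}PC.
rewrite -m2E.
apply: (g_sigma_algebra_measure_unique G mG (fun=> setT)) => //.
- by apply/seteqP; split => // w _; exists 0%N.
- move=> _ [D mD <-].
  rewrite m2E /m1 /= /mrestr.
  have hJ : (P (cyl D) = \prod_(j <- J) P (X j @^-1` D j))%E.
    by apply: indX => // j /=; rewrite JP => /andP[].
  pose D' j := if j == k.+1 then C else D j.
  have kJ : k.+1 \notin J by rewrite JP ltnn andbF.
  have := indX (k.+1 |` J)%fset _ D'.
  rewrite big_fsetU1//= /D' eqxx.
  have -> : (\prod_(j <- J) P (X j @^-1` (if j == k.+1 then C else D j)) =
      \prod_(j <- J) P (X j @^-1` D j))%E.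
    by apply: eq_big_seq => j jJ; case: eqP jJ kJ => // -> ->.
  rewrite -hJ [RHS]muleC => <-.
  + congr (P _); apply/seteqP; split=> [w [h1 h2] j /=|w h].
      by rewrite in_fset1U => /orP[/eqP ->|jJ]; [rewrite eqxx|case: eqP => [->//|_]; exact: (h1 j jJ)].
    split; last by have := h k.+1; rewrite /= in_fset1U eqxx /=; exact.
    move=> j /= jJ; have := h j; rewrite /= in_fset1U jJ orbT => /(_ isT).
    by case: eqP jJ kJ => // -> ->.
  + by move=> j /=; rewrite in_fset1U => /orP[/eqP ->//|]; rewrite JP => /andP[].
  + by move=> j; case: ifP.
- move=> _; apply: (@le_lt_trans _ _ 1%E); last exact: ltry.
  by apply: probability_le1; apply: measurableI => //; exact: (mpre _ _ mC).
- exact: sub.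
Qed.

(** Independence makes the joint law of [Y] and [Z] a product measure, so that
    Tonelli's theorem integrates out [Z] first, with [Y] held fixed. *)
Lemma expectation_independent_le d1 (H : measurableType d1) (Y : Omega -> H)
    (Z : {RV P >-> Xi}) (D : probability Xi R) (f : H * Xi -> R) (phi : H -> R) :
  measurable_fun setT Y ->
  (forall A C, measurable A -> measurable C ->
    P (Y @^-1` A `&` Z @^-1` C) = P (Y @^-1` A) * D C)%E ->
  measurable_fun setT f -> (forall z, 0 <= f z) ->
  measurable_fun setT phi -> (forall h, 0 <= phi h) ->
  (forall h, 'E_D[(fun y => f (h, y))] <= (phi h)%:E)%E ->
  ('E_P[(fun w => f (Y w, Z w))] <= 'E_P[(fun w => phi (Y w))])%E.
Proof.
move=> mY ind mf f0 mphi phi0 fphi.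
pose Yf : {RV P >-> H} := HB.pack Y (isMeasurableFun.Build _ _ _ _ Y mY).
have mYZ : measurable_fun setT (fun w => (Y w, Z w)) by apply: measurable_fun_pair.
pose YZ : {RV P >-> (H * Xi)%type} :=
  HB.pack (fun w => (Y w, Z w)) (isMeasurableFun.Build _ _ _ _ _ mYZ).
have mfE : measurable_fun setT (EFin \o f) by exact/measurable_EFinP.
have fE0 z : (0 <= (EFin \o f) z)%E by rewrite lee_fin.
have mphiE : measurable_fun setT (EFin \o phi) by exact/measurable_EFinP.
have phiE0 h : (0 <= (EFin \o phi) h)%E by rewrite lee_fin.
rewrite unlock -(ge0_integral_distribution YZ mfE fE0).
rewrite -(ge0_integral_distribution Yf mphiE phiE0).
have prodE : forall A, measurable A -> A `<=` setT ->
    distribution P YZ A = (distribution P Yf \x D)%E A.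
  by move=> A mA _; apply/esym; exact: product_measure_unique.
rewrite (eq_measure_integral _ prodE) fubini_tonelli1//.
apply: ge0_le_integral => //.
- by move=> h _; apply: integral_ge0 => y _; exact: fE0.
- exact: measurable_fun_fubini_tonelli_F.
- by move=> h _; have := fphi h; rewrite unlock.
Qed.

End Independence.

(** * Moments of the accumulated noise *)

Section MomentRecursion.
Context {R : realType} {d d' : measure_display}.
Context {Omega : measurableType d} {Xi : measurableType d'}.
Variable P : probability Omega R.
Context {B V : normedModType R}.
Variables (xi0 : {RV P >-> Xi}) (xi : nat -> {RV P >-> Xi}).
Hypothesis hxi : independent_copies xi0 xi.
Variables (g : B -> Xi -> V) (G : B -> V).
Hypotheses (hg : measurable_oracle g) (cG : continuous G).
Variables (p C sigma : R).
Hypotheses (p1 : 1 < p) (C0 : 0 <= C) (sigma0 : 0 < sigma).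
Hypothesis smoothV : forall u v : V,
  `|u + v| `^ p + `|u - v| `^ p <= 2 * `|u| `^ p + C * `|v| `^ p.
Hypothesis gE : forall x : B, has_expectation P (fun w => g x (xi0 w)) (G x).
Hypothesis gp : forall x : B,
  ('E_P[(fun w => `|g x (xi0 w) - G x| `^ p)%R] <= (sigma `^ p)%:E)%E.

Let D := distribution P xi0.

Lemma expectation_distribution (f : Xi -> R) : measurable_fun setT f ->
  (forall y, 0 <= f y) -> 'E_D[f]%E = 'E_P[(fun w => f (xi0 w))]%E.
Proof.
move=> mf f0; rewrite unlock (@ge0_integral_distribution _ _ _ _ _ P xi0 (EFin \o f))//.
exact/measurable_EFinP.
Qed.

Lemma expectation_copy t (f : Xi -> R) : (1 <= t)%N -> measurable_fun setT f ->
  (forall y, 0 <= f y) ->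
  'E_P[(fun w => f (xi t w))]%E = 'E_P[(fun w => f (xi0 w))]%E.
Proof.
move=> t1 mf f0; have mfE : measurable_fun setT (EFin \o f) by exact/measurable_EFinP.
have fE0 y : (0 <= (EFin \o f) y)%E by rewrite lee_fin.
rewrite unlock -(ge0_integral_distribution (xi t) mfE fE0).
rewrite -(ge0_integral_distribution xi0 mfE fE0).
by apply: eq_measure_integral => A mA _; exact: hxi.2.
Qed.

Lemma measurable_pnorm d1 (T : measurableType d1) (f : T -> V) :
  smeas f -> measurable_fun setT (fun t => `|f t| `^ p).
Proof.
by move=> mf; apply: (measurableT_comp (measurable_powR p)); exact: measurable_smeas_norm.
Qed.

Lemma smeas_oracle1 (x : B) : smeas (g x).
Proof.
apply: (@smeas_oracle _ _ _ _ _ _ _ g (fun=> x) id hg) => //.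
exact: smeas_cst.
Qed.

(** One step for a deterministic past: smoothness bounds the sum of the two
    symmetric moments, and Jensen's inequality bounds the second from below. *)
Lemma pnorm_step (x : B) (s : V) (a : R) : 0 < a ->
  ('E_D[(fun y => `|s + a *: (g x y - G x)| `^ p)%R] <=
   (`|s| `^ p + C * a `^ p * sigma `^ p)%:E)%E.
Proof.
move=> a0; have mgG : smeas (fun y => g x y - G x).
  by apply: smeasB (smeas_oracle1 x) _; exact: smeas_cst.
pose f1 y := `|s + a *: (g x y - G x)| `^ p.
pose f2 y := `|s - a *: (g x y - G x)| `^ p.
pose f3 y := `|g x y - G x| `^ p.
have m1 : measurable_fun setT f1.
  by apply/measurable_pnorm/smeasD; [exact: smeas_cst|exact: smeasZ].
have m2 : measurable_fun setT f2.
  by apply/measurable_pnorm/smeasB; [exact: smeas_cst|exact: smeasZ].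
have m3 : measurable_fun setT f3 by exact: measurable_pnorm.
have f10 y : 0 <= f1 y by exact: powR_ge0.
have f20 y : 0 <= f2 y by exact: powR_ge0.
have f30 y : 0 <= f3 y by exact: powR_ge0.
have E3 : ('E_D[f3] <= (sigma `^ p)%:E)%E by rewrite expectation_distribution//; exact: gp.
have E2 : ((`|s| `^ p)%:E <= 'E_D[f2])%E.
  rewrite expectation_distribution//.
  have f2E w : f2 (xi0 w) = a `^ p * `|g x (xi0 w) - (G x + a^-1 *: s)| `^ p.
    rewrite /f2 -powRM ?(ltW a0)// -[in X in X * _](gtr0_norm a0) -normrZ.
    by rewrite opprD addrA [in RHS]scalerBr scalerA mulfV ?gt_eqF// scale1r distrC.
  rewrite (_ : (fun w => f2 (xi0 w)) =
    (fun w => a `^ p * `|g x (xi0 w) - (G x + a^-1 *: s)| `^ p)); last exact/funext.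
  rewrite expectation_ge0Z ?powR_ge0//; last first.
    apply: measurable_pnorm; apply: smeasB; last exact: smeas_cst.
    by apply: smeas_precomp (smeas_oracle1 x); exact: measurable_funPT.
  have := has_expectation_pnorm (G x + a^-1 *: s) p1 (gE x).
  rewrite opprD addrA subrr add0r normrN normrZ gtr0_norm ?invr_gt0// => h.
  apply: le_trans (lee_wpmul2l _ h); last by rewrite lee_fin powR_ge0.
  by rewrite -EFinM -powRM ?(ltW a0)// ?mulr_ge0 ?invr_ge0 ?(ltW a0)// mulrA mulfV ?gt_eqF// mul1r.
have sum : ('E_D[f1] + 'E_D[f2] <= (2 * `|s| `^ p + C * a `^ p * sigma `^ p)%:E)%E.
  rewrite -expectation_ge0D//.
  apply: (@le_trans _ _ 'E_D[(fun y => 2 * `|s| `^ p + C * a `^ p * f3 y)%R]%E).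
    apply: expectation_ge0_le.
    - exact: measurable_funD.
    - by apply: measurable_funD => //; exact: measurable_funM.
    - by move=> y; exact: addr_ge0.
    - move=> y; apply: le_trans (smoothV _ _) _.
      by rewrite lerD2l normrZ (gtr0_norm a0) powRM ?(ltW a0)// mulrA.
  have Ca0 : 0 <= C * a `^ p by rewrite mulr_ge0// powR_ge0.
  have mCf : measurable_fun setT (fun y => C * a `^ p * f3 y) by exact: measurable_funM.
  rewrite (expectation_ge0D D (measurable_cst _) mCf)//; last 2 first.
  - by move=> y; rewrite mulr_ge0// powR_ge0.
  - by move=> y; rewrite mulr_ge0// powR_ge0.
  rewrite expectation_const expectation_ge0Z//.
  by rewrite [leRHS]EFinD leeD2l// [leRHS]EFinM lee_wpmul2l.
have : ('E_D[f1] + (`|s| `^ p)%:E <= (2 * `|s| `^ p + C * a `^ p * sigma `^ p)%:E)%E.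
  by apply: le_trans sum; rewrite leeD2l.
rewrite -leeBrDr// => /le_trans; apply.
by rewrite -EFinB lee_fin; lra.
Qed.

Lemma measurable_history_id k :
  measurable_fun setT (id : Omega -> historyT xi k).
Proof.
by move=> _ A mA; rewrite setTI; exact: (@history_measurable _ _ _ _ _ P xi k).
Qed.

Lemma measurable_historyS k :
  measurable_fun setT (id : historyT xi k.+1 -> historyT xi k).
Proof. by move=> _ A mA; rewrite setTI; exact: (@historyS _ _ _ _ _ P xi k). Qed.

Lemma measurable_history_last k :
  measurable_fun setT (xi k.+1 : historyT xi k.+1 -> Xi).
Proof. by move=> _ A mA; rewrite setTI; exact: history_last. Qed.

Lemma smeas_historyS k (W : normedModType R) (f : Omega -> W) :
  smeas (f : historyT xi k -> W) -> smeas (f : historyT xi k.+1 -> W).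
Proof. exact: (smeas_precomp (@measurable_historyS k)). Qed.

Lemma smeas_history k (W : normedModType R) (f : Omega -> W) :
  smeas (f : historyT xi k -> W) -> smeas f.
Proof. exact: (smeas_precomp (@measurable_history_id k)). Qed.

Variables (x : nat -> Omega -> B) (a : R).
Hypotheses (a0 : 0 < a) (a1 : a <= 1).
Hypothesis mx : forall k, smeas (x k.+1 : historyT xi k -> B).

Definition noise_error (t : nat) (w : Omega) : V := g (x t w) (xi t w) - G (x t w).

(** Starts from zero: the initial error is kept apart, since its moment is
    only bounded by [sigma^p], without the factor [a^(p-1)]. *)
Fixpoint noise (t : nat) (w : Omega) : V :=
  if t is k.+1 then (1 - a) *: noise k w + a *: noise_error k.+1 w else 0.

Lemma smeas_noise_error k : smeas (noise_error k.+1 : historyT xi k.+1 -> V).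
Proof.
have mxk : smeas (x k.+1 : historyT xi k.+1 -> B) by exact: smeas_historyS.
apply: smeasB; last exact: smeas_comp.
exact: (smeas_oracle hg mxk (@measurable_history_last k)).
Qed.

Lemma smeas_noise k : smeas (noise k : historyT xi k -> V).
Proof.
elim: k => [|k ih]; first exact: smeas_cst.
apply: smeasD; first exact: (smeasZ _ (smeas_historyS ih)).
exact: (smeasZ _ (@smeas_noise_error k)).
Qed.

(** [noise k] and [x k.+1] depend on the first [k] samples only, so [pnorm_step]
    applies with the history held fixed. *)
Lemma noise_step k :
  ('E_P[(fun w => `|noise k.+1 w| `^ p)%R] <=
   (1 - a)%:E * 'E_P[(fun w => `|noise k w| `^ p)%R] + (C * a `^ p * sigma `^ p)%:E)%E.
Proof.
pose f (z : historyT xi k * Xi) : R :=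
  `|(1 - a) *: noise k z.1 + a *: (g (x k.+1 z.1) z.2 - G (x k.+1 z.1))| `^ p.
pose phi (h : historyT xi k) : R :=
  `|(1 - a) *: noise k h| `^ p + C * a `^ p * sigma `^ p.
have b0 : 0 <= 1 - a by rewrite subr_ge0.
have c0 : 0 <= C * a `^ p * sigma `^ p by rewrite !mulr_ge0// powR_ge0.
have mS := smeas_noise k.
have mf : measurable_fun setT f.
  apply: measurable_pnorm; apply: smeasD.
    exact: (smeasZ _ (smeas_precomp measurable_fst mS)).
  have mxf : smeas (fun z : historyT xi k * Xi => x k.+1 z.1).
    exact: (smeas_precomp measurable_fst (mx k)).
  apply: smeasZ.
  apply: smeasB; last exact: (smeas_comp cG mxf).
  exact: (smeas_oracle hg mxf measurable_snd).
have mphi : measurable_fun setT phi.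
  by apply: measurable_funD => //; apply: measurable_pnorm; exact: smeasZ.
have := @expectation_independent_le _ _ _ _ _ P _ (historyT xi k) id (xi k.+1) D f phi
  (@measurable_history_id k) _ mf _ mphi _ _.
have ind A E : measurable A -> measurable E ->
    (P ((id : Omega -> historyT xi k) @^-1` A `&` xi k.+1 @^-1` E) =
     P ((id : Omega -> historyT xi k) @^-1` A) * D E)%E.
  move=> mA mE; rewrite (history_independent hxi.1 mE mA).
  by congr (_ * _)%E; exact: hxi.2.
move=> /(_ ind).
have f0 z : 0 <= f z by exact: powR_ge0.
have phi0 h : 0 <= phi h by rewrite addr_ge0// powR_ge0.
have fphi h : ('E_D[(fun y => f (h, y))] <= (phi h)%:E)%E.
  exact: (pnorm_step (x k.+1 h) ((1 - a) *: noise k h) a0).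
move=> /(_ f0 phi0 fphi) /le_trans; apply.
have mn := measurable_pnorm (smeas_history mS).
have mnZ : measurable_fun setT (fun w => `|(1 - a) *: noise k w| `^ p).
  by apply: measurable_pnorm; apply: smeasZ; exact: smeas_history mS.
rewrite /phi (expectation_ge0D P mnZ)//.
rewrite expectation_const leeD2r// -expectation_ge0Z//.
apply: expectation_ge0_le => //.
  exact: measurable_funM.
move=> w; rewrite normrZ ger0_norm// powRM//.
rewrite ler_wpM2r ?powR_ge0//.
have [->|bn0] := eqVneq (1 - a) 0; first by rewrite powR0// gt_eqF// (lt_trans ltr01).
by apply: ge1r_powR; rewrite ?(ltW p1)// lt0r bn0 b0/= gerBl ltW.
Qed.

(** The bound is the fixed point of the recursion [noise_step]. *)
Lemma noise_moment k :
  ('E_P[(fun w => `|noise k w| `^ p)%R] <= (C * a `^ (p - 1) * sigma `^ p)%:E)%E.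
Proof.
have p0 : 0 < p by exact: lt_trans p1.
elim: k => [|k ih].
  rewrite (_ : (fun w => _) = fun=> 0); last first.
    by apply/funext => w; rewrite /= normr0 powR0 ?gt_eqF.
  by rewrite expectation_const lee_fin !mulr_ge0// powR_ge0.
apply: le_trans (noise_step k) _.
have b0 : 0 <= 1 - a by rewrite subr_ge0.
apply: (@le_trans _ _ ((1 - a)%:E * (C * a `^ (p - 1) * sigma `^ p)%:E +
    (C * a `^ p * sigma `^ p)%:E)%E).
  by rewrite leeD2r// lee_wpmul2l.
rewrite -EFinM -EFinD lee_fin -(mulr_powRB1 (ltW a0) p0).
set u := a `^ (p - 1); set v := sigma `^ p.
by rewrite le_eqVlt; apply/orP; left; apply/eqP; ring.
Qed.

Lemma noise_first_moment k (A : R) : 0 < A -> C * a `^ (p - 1) * sigma `^ p <= A `^ p ->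
  ('E_P[(fun w => `|noise k w|)%R] <= A%:E)%E.
Proof.
move=> A0 hA; apply: (expectation_le_pnorm p1 A0) => //.
  exact: measurable_smeas_norm (smeas_history (@smeas_noise k)).
by apply: le_trans (noise_moment k) _; rewrite lee_fin.
Qed.

Lemma oracle_error_first_moment (z : B) (t : nat) : (1 <= t)%N ->
  ('E_P[(fun w => `|g z (xi t w) - G z|)%R] <= sigma%:E)%E.
Proof.
move=> t1; have mgz : smeas (fun y => g z y - G z).
  by apply: smeasB (smeas_oracle1 z) _; exact: smeas_cst.
apply: (expectation_le_pnorm p1 sigma0) => //.
  apply: measurable_smeas_norm; apply: (smeas_precomp _ mgz).
  exact: measurable_funPT.
rewrite (expectation_copy (f := fun y => `|g z y - G z| `^ p) t1); first exact: gp.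
  exact: measurable_pnorm.
by move=> y; exact: powR_ge0.
Qed.

End MomentRecursion.

(** * Choice of the parameters *)

Section StepsizeTuning.
Context {R : realType}.

Lemma powR_expR (Y r : R) : expR Y `^ r = expR (r * Y).
Proof. by rewrite /powR gt_eqF ?expR_gt0// expRK. Qed.

Lemma sqrt_expR (Y : R) : Num.sqrt (expR Y) = expR (Y / 2).
Proof.
by rewrite -powR12_sqrt ?expR_ge0// powR_expR mulrC.
Qed.

Variables (p Delta L sigma K T a : R).
Hypotheses (p1 : 1 < p) (Delta0 : 0 < Delta) (L0 : 0 < L) (sigma0 : 0 < sigma).
Hypotheses (K1 : 1 <= K) (T1 : 1 <= T).

Let u := T `^ (- (p / (2 * p - 1))).
Let v := (Delta * L / (sigma ^+ 2 * K ^+ 2 * T)) `^ (p / (3 * p - 2)).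
Let y := Delta * L / T.
Let M := (y * (sigma * K) `^ (p / (p - 1))) `^ ((p - 1) / (3 * p - 2)).
Let N := sigma * K / T `^ ((p - 1) / (2 * p - 1)).

(** In exponential coordinates the identities between real powers become
    identities between rational functions of [p]. *)
Lemma tuning_exp : exists Y S,
  [/\ y = expR Y, sigma * K = expR S & v = expR (p / (3 * p - 2) * (Y - 2 * S))].
Proof.
have T0 : 0 < T by exact: lt_le_trans T1.
have K0 : 0 < K by exact: lt_le_trans K1.
have y0 : 0 < y by rewrite divr_gt0// mulr_gt0.
have s0 : 0 < sigma * K by rewrite mulr_gt0.
exists (ln y), (ln (sigma * K)); rewrite !lnK ?posrE//; split=> //.
rewrite -powR_expR expRD expRN (expRM_natl 2) !lnK ?posrE//.
rewrite /v /y; congr (_ `^ _).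
by field; rewrite !gt_eqF.
Qed.

Lemma tuning_M_gt0 : 0 < M.
Proof.
have [Y [S [yE sE _]]] := tuning_exp.
by rewrite /M yE sE powR_expR -expRD powR_expR expR_gt0.
Qed.

Lemma tuning_sqrt_M : Num.sqrt (y / v) = M.
Proof.
have [Y [S [yE sE vE]]] := tuning_exp.
rewrite /M sE yE vE -expRN -expRD sqrt_expR !powR_expR -expRD powR_expR.
have p10 : p - 1 != 0 by rewrite subr_eq0 gt_eqF.
have p30 : 3 * p - 2 != 0 by apply: lt0r_neq0; move: p1; lra.
by congr expR; field; rewrite p10 p30.
Qed.

Lemma tuning_pow_M : sigma * K * v `^ ((p - 1) / p) = M.
Proof.
have [Y [S [yE sE vE]]] := tuning_exp.
rewrite /M sE yE vE !powR_expR -!expRD powR_expR.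
have p0 : p != 0 by apply: lt0r_neq0; move: p1; lra.
have p10 : p - 1 != 0 by rewrite subr_eq0 gt_eqF.
have p30 : 3 * p - 2 != 0 by apply: lt0r_neq0; move: p1; lra.
by congr expR; field; rewrite p0 p10 p30.
Qed.

Lemma tuning_pow_N : sigma * K * u `^ ((p - 1) / p) = N.
Proof.
have p0 : p != 0 by apply: lt0r_neq0; move: p1; lra.
have p20 : 2 * p - 1 != 0 by apply: lt0r_neq0; move: p1; lra.
rewrite /N /u -powRrM -powRN; congr (_ * _ `^ _).
by field; rewrite p0 p20.
Qed.

Lemma tuning_inv_N : sigma * K / (u * T) = N.
Proof.
have T0 : 0 < T by exact: lt_le_trans T1.
have p20 : 2 * p - 1 != 0 by apply: lt0r_neq0; move: p1; lra.
rewrite /N /u -[X in _ / (_ * X)](powRr1 (ltW T0)) -powRD; last by rewrite (gt_eqF T0) implybT.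
by congr (_ / _ `^ _); field; rewrite p20.
Qed.

Hypothesis aE : a = Num.min 1 (Num.max u v).

Lemma tuning_a_gt0 : 0 < a.
Proof.
have T0 : 0 < T by exact: lt_le_trans T1.
by rewrite aE lt_min ltr01 lt_max powR_gt0.
Qed.

Lemma tuning_a_le1 : a <= 1.
Proof. by rewrite aE ge_min lexx. Qed.

(** The terms in [Delta] and [eta] add up to at most [3 sqrt (y / a)], and
    [sqrt (y / a)] is at most [sqrt y] if [a = 1] and at most [M] if [a >= v];
    [a >= u] bounds the initial error by [N]; [a <= max u v] bounds the
    accumulated noise by [N + M] up to a constant factor. *)
Lemma tuned_rate (eta K' : R) : eta = Num.sqrt (Delta * a / (L * T)) ->
  1 <= K' <= 2 * K ->
  0 < eta /\
  Delta / (eta * T) + 2 * sigma / (a * T) + 2 * L * eta * (1 - a) / a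
    + 2 * (2 * K' * sigma * a `^ ((p - 1) / p)) + L * eta / 2
  <= 9 * Num.sqrt y + 14 * M + 10 * N.
Proof.
move=> etaE /andP[K'1 K'2].
have T0 : 0 < T by exact: lt_le_trans T1.
have K0 : 0 < K by exact: lt_le_trans K1.
have a0 := tuning_a_gt0; have a1 := tuning_a_le1.
have y0 : 0 < y by rewrite divr_gt0// mulr_gt0.
have M0 := tuning_M_gt0.
have v0 : 0 < v by have [Y [S [_ _ ->]]] := tuning_exp; exact: expR_gt0.
have N0 : 0 < N by rewrite divr_gt0 ?mulr_gt0// powR_gt0.
have p0 : 0 < p by exact: lt_trans p1.
have e0 : 0 <= (p - 1) / p by rewrite divr_ge0 ?subr_ge0 ?ltW.
have u1 : u <= 1.
  rewrite /u powRN invf_le1 ?powR_gt0// -[X in X <= _](powRr0 T) ler_powR//.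
  by apply: divr_ge0; [exact: ltW|move: p1; lra].
have u0 : 0 < u by rewrite powR_gt0.
set r := Num.sqrt (y / a).
have r0 : 0 < r by rewrite sqrtr_gt0 divr_gt0.
have r2 : r ^+ 2 = y / a by rewrite sqr_sqrtr// divr_ge0 ?ltW.
have etaE2 : L * eta = a * r.
  have -> : eta = a / L * r.
    rewrite etaE (_ : Delta * a / (L * T) = (a / L) ^+ 2 * (y / a)).
      by rewrite sqrtrM ?sqr_ge0// sqrtr_sqr ger0_norm// divr_ge0 ?ltW.
    by rewrite /y; field; rewrite !gt_eqF.
  by field; rewrite gt_eqF.
have eta0 : 0 < eta by rewrite -(pmulr_rgt0 _ L0) etaE2 mulr_gt0.
split=> //.
have t1 : Delta / (eta * T) = r.
  have -> : Delta / (eta * T) = y / (L * eta) by rewrite /y; field; rewrite !gt_eqF.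
  rewrite etaE2 -[in LHS](divfK (lt0r_neq0 a0) y) -r2 expr2; field; rewrite !gt_eqF//.
have t2 : r <= Num.sqrt y + M.
  have : 1 <= a \/ v <= a.
    rewrite aE; case: (leP 1 (Num.max u v)) => _; first by left.
    by right; rewrite le_max lexx orbT.
  case=> [ga|va].
    apply: (@le_trans _ _ (Num.sqrt y)); last by rewrite lerDl ltW.
    by rewrite ler_wsqrtr// ler_pdivrMr// ler_peMr// ltW.
  apply: (@le_trans _ _ M); last by rewrite lerDr sqrtr_ge0.
  by rewrite -tuning_sqrt_M ler_wsqrtr// ler_pM2l// lef_pV2// posrE.
have t3 : sigma / (a * T) <= N.
  have ua : u <= a by rewrite aE le_min u1 le_max lexx.
  rewrite -tuning_inv_N; apply: ler_pM; rewrite ?invr_ge0 ?ler_peMr ?(ltW sigma0)//.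
    by rewrite mulr_ge0 ?ltW.
  by rewrite lef_pV2 ?posrE ?mulr_gt0// ler_pM2r.
have t4 : sigma * K * a `^ ((p - 1) / p) <= N + M.
  have : a <= u \/ a <= v.
    have : a <= Num.max u v by rewrite aE ge_min lexx orbT.
    by rewrite le_max => /orP.
  have s0 : 0 < sigma * K by rewrite mulr_gt0.
  case=> h.
    apply: (@le_trans _ _ N); last by rewrite lerDl ltW.
    by rewrite -tuning_pow_N ler_pM2l// ge0_ler_powR ?nnegrE// ltW.
  apply: (@le_trans _ _ M); last by rewrite lerDr ltW.
  by rewrite -tuning_pow_M ler_pM2l// ge0_ler_powR ?nnegrE// ltW.
have t5 : L * eta / 2 + 2 * L * eta * (1 - a) / a <= 2 * r.
  have -> : 2 * L * eta * (1 - a) / a = 2 * r * (1 - a).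
    by rewrite -(mulrA 2) etaE2; field; rewrite gt_eqF.
  rewrite etaE2; have : 0 < a * r by exact: mulr_gt0.
  lra.
have t6 : K' * sigma * a `^ ((p - 1) / p) <= 2 * (N + M).
  apply: (@le_trans _ _ (2 * (sigma * K * a `^ ((p - 1) / p)))); last first.
    by rewrite ler_pM2l.
  rewrite !mulrA ler_wpM2r ?powR_ge0//.
  by rewrite mulrAC ler_pM2r.
have :=  sqrtr_ge0 y.
move: t1 t2 t3 t5 t6 M0 N0; lra.
Qed.

End StepsizeTuning.

(** * Unrolling the recursions *)

Section Momentum.
Context {R : realType}.

Lemma momentum_identity (V : lmodType R) (a : R) (m s h h' n : V) :
  (1 - a) *: m + a *: s - h' - ((1 - a) *: n + a *: (s - h')) =
  (1 - a) *: ((m - h - n) + (h - h')).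
Proof.
rewrite (addrAC m) subrKA !scalerBr opprD opprB.
rewrite (scalerBl 1 a h') scale1r opprB.
move: ((1 - a) *: m) ((1 - a) *: n) (a *: s) (a *: h') => x y z t.
rewrite [x + z - _]addrAC [- y + _]addrA [- y + t]addrC.
by rewrite addrACA subrr addr0 addrACA [RHS]addrACA [- h' - y]addrC.
Qed.

(** The momentum error minus the weighted noise contracts by [1 - a] at each step
    after the gradient has moved by at most [delta]; [delta (1 - a) / a] is the
    fixed point of this recursion. *)
Lemma momentum_error (V : normedModType R) (a delta : R) (m gs gr ns : nat -> V) :
  0 < a -> a <= 1 -> 0 <= delta ->
  m 0%N = gs 1%N ->
  (forall t, m t.+1 = (1 - a) *: m t + a *: gs t.+1) ->
  ns 0%N = 0 ->
  (forall t, ns t.+1 = (1 - a) *: ns t + a *: (gs t.+1 - gr t.+1)) ->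
  (forall t, `|gr t.+1 - gr t.+2| <= delta) ->
  forall t, `|m t.+1 - gr t.+1| <=
    (1 - a) ^+ t.+1 * `|gs 1%N - gr 1%N| + delta * (1 - a) / a + `|ns t.+1|.
Proof.
move=> a0 a1 delta0 m0 mS ns0 nsS grd.
have b0 : 0 <= 1 - a by rewrite subr_ge0.
(* the gradient at index 0 is read at the starting point *)
pose gr' t := gr t.-1.+1.
have drift t : `|gr' t - gr t.+1| <= delta.
  by case: t => [|t]; [rewrite /gr' subrr normr0|exact: grd].
have main t : `|m t - gr' t - ns t| <=
    (1 - a) ^+ t * `|gs 1%N - gr 1%N| + delta * (1 - a) / a.
  elim: t => [|t ih].
    rewrite m0 ns0 subr0 expr0 mul1r lerDl.
    by rewrite divr_ge0 ?(ltW a0)// mulr_ge0.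
  have -> : m t.+1 - gr' t.+1 - ns t.+1 =
      (1 - a) *: ((m t - gr' t - ns t) + (gr' t - gr t.+1)).
    rewrite mS nsS /gr' /=.
    exact: momentum_identity.
  rewrite normrZ ger0_norm//.
  apply: (@le_trans _ _ ((1 - a) * ((1 - a) ^+ t * `|gs 1%N - gr 1%N| + delta * (1 - a) / a + delta))).
    by rewrite ler_wpM2l// (le_trans (ler_normD _ _))// lerD.
  rewrite exprS le_eqVlt; apply/orP; left; apply/eqP; field; exact: lt0r_neq0.
move=> t; have := main t.+1; rewrite /gr' /= => h.
rewrite -[X in `|X| <= _](subrK (ns t.+1)).
by apply: le_trans (ler_normD _ _) _; rewrite lerD2r.
Qed.

Lemma discount_sum (a : R) (n : nat) : 0 < a -> a <= 1 ->
  \sum_(0 <= t < n) (1 - a) ^+ t.+1 <= a^-1.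
Proof.
move=> a0 a1; have b0 : 0 <= 1 - a by rewrite subr_ge0.
have -> : \sum_(0 <= t < n) (1 - a) ^+ t.+1 = (1 - a) * (1 - (1 - a) ^+ n) / a.
  elim: n => [|n ih]; first by rewrite big_geq// expr0 subrr mulr0 mul0r.
  by rewrite big_nat_recr//= ih !exprS; field; exact: lt0r_neq0.
rewrite -[leRHS]mul1r ler_wpM2r ?invr_ge0 ?(ltW a0)//.
by rewrite mulr_ile1 ?gerBl ?(ltW a0) ?exprn_ge0// subr_ge0 exprn_ile1 // gerBl ltW.
Qed.

Lemma descent_sum (phi gn e : nat -> R) (eta c : R) (n : nat) :
  (forall t, eta * gn t.+1 <= phi t.+1 - phi t.+2 + 2 * eta * e t.+1 + c) ->
  eta * \sum_(0 <= t < n) gn t.+1 <=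
  phi 1%N - phi n.+1 + 2 * eta * \sum_(0 <= t < n) e t.+1 + n%:R * c.
Proof.
move=> h; elim: n => [|n ih].
  by rewrite !big_geq// !mulr0 subrr mul0r !addr0.
rewrite !big_nat_recr//= !mulrDr -natr1 mulrDl mul1r.
by have := h n; move: ih; lra.
Qed.

End Momentum.

(** * Convergence rate *)

Unset Implicit Arguments.
Set Strict Implicit.

Theorem mainTheorem1 (R : realType) (p q : R) (hp1 : 1 < p) (hp2 : p <= 2)
  (hq : q = p / (p - 1))
  (B : completeNormedModType R)
  (K : R) (hK : convexity_constant B q = K%:E)
  (d d' : measure_display) (Omega : measurableType d) (Xi : measurableType d')
  (P : probability Omega R)
  (xi0 : {RV P >-> Xi}) (xi : nat -> {RV P >-> Xi})
  (hxi : independent_copies xi0 xi)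
  (F : B -> R^o) (gradF : B -> dual B)
  (hF : forall x : B, is_diff x F (gradF x))
  (g : B -> Xi -> dual B) (hg : measurable_oracle g)
  (x1 : B) (Delta1 L sigma : R) (hL : 0 < L) (hsigma : 0 < sigma)
  (h1 : ((F x1)%:E - ereal_inf [set (F x)%:E | x in [set: B]] <= Delta1%:E)%E)
  (h2 : forall x y : B, `|gradF x - gradF y| <= L * `|x - y|)
  (h3 : forall x : B, has_expectation P (fun w => g x (xi0 w)) (gradF x))
  (h3' : forall x : B,
    ('E_P[(fun w => `|g x (xi0 w) - gradF x| `^ p)%R] <= (sigma `^ p)%:E)%E)
  (T : nat) (hT : (1 <= T)%N)
  (beta eta : R)
  (hbeta : beta = 1 - Num.min 1 (Num.max
     (T%:R `^ (- (p / (2 * p - 1))))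
     ((Delta1 * L / (sigma ^+ 2 * K ^+ 2 * T%:R)) `^ (p / (3 * p - 2)))))
  (heta : eta = Num.sqrt (Delta1 * (1 - beta) / (L * T%:R)))
  (x : nat -> Omega -> B) (m : nat -> Omega -> dual B) (dir : nat -> Omega -> B)
  (hrun : nssdm g xi x1 (fun _ => eta) (fun _ => beta) x m dir) :
  (T%:R^-1%:E * \sum_(1 <= t < T.+1) 'E_P[(fun w => `|gradF (x t w)|)%R] <=
   (9 * Num.sqrt (Delta1 * L / T%:R)
    + 14 * (Delta1 * L / T%:R * (sigma * K) `^ (p / (p - 1)))
             `^ ((p - 1) / (3 * p - 2))
    + 10 * (sigma * K / T%:R `^ ((p - 1) / (2 * p - 1))))%:E)%E.
Proof.
have [K1 [K' K'b hconv]] := convexity_constantP hK.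
have K'1 : 1 <= K' by move: K'b => /andP[].
have p0 : 0 < p by exact: lt_trans hp1.
have smooth f h : `|f + h| `^ p + `|f - h| `^ p <=
    2 * `|f| `^ p + 2 * K' `^ p * `|h| `^ p := dual_smooth hp1 hq K'1 hconv f h.
have gap y : F x1 - F y <= Delta1.
  rewrite -lee_fin EFinB; apply: le_trans h1; apply: leeB => //.
  by apply: ereal_inf_lbound; exists y.
have Delta0 : 0 <= Delta1 by have := gap x1; rewrite subrr.
have T0 : 0 < T%:R :> R by rewrite ltr0n.
have T1 : 1 <= T%:R :> R by rewrite ler1n.
case: hrun => x1E m0E runE dirM.
have cG : continuous gradF.
  move=> z; apply/cvgrPdist_le => e e0; near=> y.
  apply: le_trans (h2 _ _) _; rewrite mulrC -ler_pdivlMr//; near: y.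
  by apply: cvgr_dist_le => //; exact: divr_gt0.
have xS t w : x t.+2 w = x t.+1 w + eta *: dir t.+1 w by have [] := runE t.+1 isT w.
rewrite big_add1 /=.
(* for [Delta1 = 0] the stepsize vanishes and the starting point is a minimiser *)
have [D0|D0] := eqVneq Delta1 0.
  have eta0 : eta = 0 by rewrite heta D0 !mul0r sqrtr0.
  have xE t w : x t.+1 w = x1.
    by elim: t => [|t ih]; [exact: x1E|rewrite xS eta0 scale0r addr0].
  have g0 : gradF x1 = 0.
    have xmin y : F x1 <= F y by rewrite -subr_le0 (le_trans (gap y))// D0.
    exact: (minimiser_gradient0 hF h2 hL xmin).
  rewrite big1 ?mule0; last first.
    move=> t _; rewrite (_ : (fun w => _) = fun=> 0) ?expectation_const//.
    by apply/funext => w; rewrite xE g0 normr0.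
  rewrite lee_fin !addr_ge0// mulr_ge0 ?sqrtr_ge0 ?powR_ge0//.
  by rewrite divr_ge0 ?powR_ge0// mulr_ge0 ?ltW// (lt_le_trans ltr01).
have {}D0 : 0 < Delta1 by rewrite lt_neqAle eq_sym D0.
pose a := Num.min 1 (Num.max (T%:R `^ (- (p / (2 * p - 1))))
     ((Delta1 * L / (sigma ^+ 2 * K ^+ 2 * T%:R)) `^ (p / (3 * p - 2)))).
have bE : 1 - beta = a by rewrite hbeta opprB addrC subrK.
have betaE : beta = 1 - a by rewrite -bE opprB addrC subrK.
have a0 : 0 < a by exact: (tuning_a_gt0 T1 (erefl a)).
have a1 : a <= 1 by exact: (tuning_a_le1 (erefl a)).
have etaE : eta = Num.sqrt (Delta1 * a / (L * T%:R)) by rewrite heta bE.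
have [eta0 rate] := tuned_rate hp1 D0 hL hsigma K1 T1 (erefl a) etaE K'b.
have C0 : 0 <= 2 * K' `^ p by rewrite mulr_ge0// powR_ge0.
have mx k : smeas (x k.+1 : historyT xi k -> B).
  elim: k => [|k ih].
    by rewrite (_ : x 1%N = fun=> x1); [exact: smeas_cst|apply/funext].
  rewrite (_ : x k.+2 = fun w => x k.+1 w + eta *: dir k.+1 w); last exact/funext/xS.
  apply: smeasD; first exact: smeas_historyS ih.
  have mdir : smeas (dir k.+1 : historyT xi k.+1 -> B) by exact: dirM.
  exact: (smeasZ _ mdir).
pose ns := noise xi g gradF x a.
pose eps w := `|g x1 (xi 1%N w) - gradF x1|.
pose A := 2 * K' * sigma * a `^ ((p - 1) / p).
have A0 : 0 < A by rewrite !mulr_gt0 ?powR_gt0// (lt_le_trans ltr01).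
have EA k : ('E_P[(fun w => `|ns k w|)%R] <= A%:E)%E.
  apply: (noise_first_moment hxi hg cG hp1 C0 smooth h3 h3' a0 a1 mx k A0).
  have K'0 : 0 <= K' by exact: le_trans K'1.
  have s0 := ltW hsigma.
  have two : 2 <= 2 `^ p :> R by rewrite -[leLHS]powRr1// ler_powR ?ler1n ?(ltW hp1).
  rewrite /A !powRM ?mulr_ge0 ?powR_ge0// -(powRrM a) divfK ?gt_eqF//.
  by rewrite mulrAC !ler_wpM2r ?powR_ge0.
have Eeps : ('E_P[eps] <= sigma%:E)%E.
  exact: (oracle_error_first_moment hxi hg hp1 hsigma h3' x1 (leqnn 1)).
(* the descent inequalities summed along one run *)
have path w : eta * \sum_(0 <= t < T) `|gradF (x t.+1 w)| <=
    (Delta1 + 2 * eta * (T%:R * (L * eta * (1 - a) / a)) + T%:R * (L / 2 * eta ^+ 2))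
    + 2 * eta / a * eps w + 2 * eta * \sum_(0 <= t < T) `|ns t.+1 w|.
  have step t : eta * `|gradF (x t.+1 w)| <= F (x t.+1 w) - F (x t.+2 w)
      + 2 * eta * `|m t.+1 w - gradF (x t.+1 w)| + L / 2 * eta ^+ 2.
    have [_ mv _] := runE t.+1 isT w; rewrite xS.
    exact: (normalised_step hF h2 (x t.+1 w) (ltW hL) (ltW eta0) mv).
  have := descent_sum (phi := fun t => F (x t w)) (gn := fun t => `|gradF (x t w)|)
    (e := fun t => `|m t w - gradF (x t w)|) T step.
  move=> /le_trans; apply.
  have err t : `|m t.+1 w - gradF (x t.+1 w)| <=
      (1 - a) ^+ t.+1 * eps w + L * eta * (1 - a) / a + `|ns t.+1 w|.
    have -> : eps w = `|g (x 1%N w) (xi 1%N w) - gradF (x 1%N w)| by rewrite x1E.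
    apply: (@momentum_error _ _ a (L * eta) (fun t => m t w)
      (fun t => g (x t w) (xi t w)) (fun t => gradF (x t w)) (fun t => ns t w)) => //.
    - by rewrite mulr_ge0 ?ltW.
    - by rewrite m0E x1E.
    - by move=> s; have [-> _ _] := runE s.+1 isT w; rewrite betaE subKr.
    - move=> s; apply: le_trans (h2 _ _) _; rewrite xS opprD addrA subrr add0r normrN normrZ.
      have [_ [dir1 _] _] := runE s.+1 isT w.
      by rewrite (gtr0_norm eta0) ler_pM2l// ler_piMr// ltW.
  have sumerr : \sum_(0 <= t < T) `|m t.+1 w - gradF (x t.+1 w)| <=
      a^-1 * eps w + T%:R * (L * eta * (1 - a) / a) + \sum_(0 <= t < T) `|ns t.+1 w|.
    apply: le_trans (ler_sum _ (fun t _ => err t)) _.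
    rewrite !big_split/= lerD2r sumr_const_nat subn0 -[X in _ + X]mulr_natl lerD2r.
    by rewrite -mulr_suml ler_wpM2r ?normr_ge0// discount_sum.
  have gapT := gap (x T.+1 w); rewrite x1E.
  have := ler_wpM2l (mulr_ge0 (ler0n _ 2) (ltW eta0)) sumerr.
  lra.
have msm k (W : normedModType R) (f : Omega -> W) :
    smeas (f : historyT xi k -> W) -> smeas f by exact: smeas_history.
have mgr t : measurable_fun setT (fun w => `|gradF (x t.+1 w)|).
  by apply: measurable_smeas_norm; apply: (smeas_comp cG); exact: msm (mx t).
have mns t : measurable_fun setT (fun w => `|ns t.+1 w|).
  by apply: measurable_smeas_norm; apply: (msm t.+1); exact: smeas_noise.
have meps : measurable_fun setT eps.
  apply: measurable_smeas_norm; apply: smeasB; last exact: smeas_cst.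
  apply: (smeas_precomp (f := g x1)); first exact: measurable_funPT.
  exact: smeas_oracle1.
set S := (\sum_(0 <= t < T) _)%E.
set c0 := Delta1 + _ + _ in path.
have c00 : 0 <= c0.
  have b0 : 0 <= 1 - a by rewrite subr_ge0.
  have ge := (ltW eta0, ltW hL, ltW a0, b0, Delta0).
  by rewrite !addr_ge0 ?(mulr_ge0, invr_ge0, exprn_ge0, ler0n, ge).
have c1 : 0 <= 2 * eta / a by rewrite divr_ge0 ?mulr_ge0 ?ltW.
have c2 : 0 <= 2 * eta by rewrite mulr_ge0 ?ltW.
have ES : (eta%:E * S <= (c0 + 2 * eta / a * sigma + 2 * eta * (T%:R * A))%:E)%E.
  rewrite /S -(expectation_ge0_sum P (index_iota 0 T) mgr)//.
  have msum := measurable_sum (index_iota 0 T) mgr.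
  have msumn := measurable_sum (index_iota 0 T) mns.
  rewrite -expectation_ge0Z ?(ltW eta0)//; last by move=> w; exact: sumr_ge0.
  have m1 : measurable_fun setT (fun w => c0 + 2 * eta / a * eps w).
    by apply: measurable_funD => //; exact: measurable_funM.
  have m2 : measurable_fun setT (fun w => 2 * eta * \sum_(0 <= t < T) `|ns t.+1 w|).
    exact: measurable_funM.
  apply: (le_trans (expectation_ge0_le _ _ _ _ path)).
  - exact: measurable_funM.
  - exact: measurable_funD.
  - by move=> w; rewrite mulr_ge0 ?(ltW eta0)// sumr_ge0.
  have eps0 w : 0 <= eps w by exact: normr_ge0.
  have mceps : measurable_fun setT (fun w => 2 * eta / a * eps w) by exact: measurable_funM.
  rewrite (expectation_ge0D P m1 m2); last 2 first.
  - by move=> w; rewrite addr_ge0// mulr_ge0.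
  - by move=> w; rewrite mulr_ge0// sumr_ge0.
  rewrite (expectation_ge0D P (measurable_cst _) mceps)//; last by move=> w; rewrite mulr_ge0.
  rewrite expectation_const (expectation_ge0Z P c1 meps)// (expectation_ge0Z P c2 msumn); last first.
    by move=> w; exact: sumr_ge0.
  rewrite (expectation_ge0_sum P (index_iota 0 T) mns)//.
  have E1 : ((2 * eta / a)%:E * 'E_P[eps] <= (2 * eta / a * sigma)%:E)%E.
    by rewrite [leRHS]EFinM lee_wpmul2l.
  have E2 : ((2 * eta)%:E * \sum_(0 <= t < T) 'E_P[(fun w => `|ns t.+1 w|)%R]
      <= (2 * eta * (T%:R * A))%:E)%E.
    rewrite [leRHS]EFinM lee_wpmul2l//.
    apply: (@le_trans _ _ (\sum_(0 <= t < T) A%:E)%E); first exact: lee_sum.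
    by rewrite sumEFin sumr_const_nat subn0 mulr_natl.
  rewrite (EFinD (c0 + 2 * eta / a * sigma)) (EFinD c0); apply: leeD; [exact: leeD2l|exact: E2].
apply: (@le_trans _ _ (T%:R^-1%:E * (eta^-1%:E *
    (c0 + 2 * eta / a * sigma + 2 * eta * (T%:R * A))%:E))%E).
  by rewrite lee_wpmul2l ?lee_fin ?invr_ge0 ?ler0n// lee_pdivlMl.
rewrite -!EFinM lee_fin; apply: le_trans rate; rewrite /c0 -/A le_eqVlt.
apply/orP; left; apply/eqP.
by field; rewrite !gt_eqF.
Unshelve. all: by end_near.
Qed.
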